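(* Let $G$ be a countably infinite amenable group with a Følner sequence $(F_N)_{N\in\mathbb{N}}$ and let $D\subseteq\mathbb{C}$ be compact. (a) For any measure preserving system $(X,\mathcal{B},\mu,(T_g)_{g\in G})$ and any measurable function $f:X\to D$ there is a sequence $(z_g)_{g\in G}$ of complex numbers in $D$ such that, for all $j\in\mathbb{N}$, all $h_1,\dots,h_j\in G$ and all continuous functions $p:D^j\to\mathbb{C}$, $$\lim_{N\to\infty}\frac{1}{|F_N|}\sum_{g\in F_N}p(z_{h_1g},\dots,z_{h_jg})=\int_Xp(f(T_{h_1}x),\dots,f(T_{h_j}x))\,d\mu(x).\qquad( * )$$ (b) Conversely, given a sequence $(z_g)_{g\in G}$ in $D$ there is a measure preserving system $(X,\mathcal{B},\mu,(T_g)_{g\in G})$ and a measurable function $f:X\to D$ such that, for all $j\in\mathbb{N}$, $h_1,\dots,h_j\in G$ and $p:D^j\to\mathbb{C}$ continuous, $( * )$ holds if the limit on the left hand side exists.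
   Context: A (left) Følner sequence in a countable group $G$ is a sequence $(F_N)_{N\in\mathbb{N}}$ of (nonempty) finite subsets of $G$ such that $\lim_{N\to\infty}\frac{|gF_N\Delta F_N|}{|F_N|}=0$ for all $g\in G$; $G$ is (left) amenable if it has a Følner sequence. A measure preserving system $(X,\mathcal{B},\mu,(T_g)_{g\in G})$ is a probability space $(X,\mathcal{B},\mu)$ together with an action $(T_g)_{g\in G}$ of $G$ on $X$ by measure preserving maps (so $T_g\circ T_h=T_{gh}$). $\mathbb{N}=\{1,2,\dots\}$. *)

(* Defs.v *)
From HB Require Import structures.
From mathcomp Require Import all_boot all_order all_algebra finmap.
From mathcomp Require Import complex.
From mathcomp Require Import all_classical all_reals all_analysis.

Set Implicit Arguments.
Unset Strict Implicit.
Unset Printing Implicit Defensive.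

Import Order.TTheory GRing.Theory Num.Theory.
Import numFieldNormedType.Exports.

Local Open Scope classical_set_scope.
Local Open Scope ring_scope.

(* The metric topology of the modulus. The module structures are left alone:
   complex.v already makes R[i] an R-module, whereas R[i]^o is an
   R[i]-module. *)
HB.instance Definition _ (R : rcfType) := PseudoPointedMetric.copy R[i] R[i]^o.
HB.instance Definition _ (R : rcfType) :=
  PseudoMetricNormedZmod.copy R[i] R[i]^o.

Section Folner.
Variables (R : realType) (G : groupType).

Definition ltranslate (g : G) (A : {fset G}) : {fset G} :=
  [fset (g * x)%g | x in A]%fset.

Definition fsymdiff (A B : {fset G}) : {fset G} :=
  ((A `\` B) `|` (B `\` A))%fset.

(* Sequences are indexed from 0 rather than 1, which does not affect limits. *)
Definition left_folner (F : nat -> {fset G}) : Prop :=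
  (forall N, F N != fset0) /\
  (forall g : G,
     (#|` fsymdiff (ltranslate g (F N)) (F N)|%:R / #|` F N|%:R : R)
       @[N --> \oo] --> (0 : R)).

Definition left_amenable : Prop := exists F, left_folner F.

Definition folner_average (F : nat -> {fset G}) (u : G -> R[i]) (N : nat) :
    R[i] :=
  (#|` F N|%:R)^-1 * \sum_(g <- F N) u g.

End Folner.

Section System.
Context {d : measure_display} (R : realType) (G : groupType).
Variables (X : measurableType d) (P : probability X R).

Record measure_preserving_action (T : G -> X -> X) : Prop := {
  mpa_id : forall x, T 1%g x = x;
  mpa_comp : forall g h x, T g (T h x) = T (g * h)%g x;
  mpa_measurable : forall g, measurable_fun setT (T g);
  mpa_preserving : forall g (A : set X), measurable A ->
    P (T g @^-1` A) = P A }.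

(* Measurability for the Borel sigma-algebra of the complex plane. *)
Definition borel_measurable (f : X -> R[i]) : Prop :=
  measurable_fun setT (f : X -> g_sigma_algebraType (@open R[i])).

(* The library integral is real-valued, so the real and imaginary parts are
   integrated separately. *)
Definition complex_integral (u : X -> R[i]) : R[i] :=
  ((\int[P]_x complex.Re (u x)) +i* (\int[P]_x complex.Im (u x)))%C.

End System.

(* D^j as a set of row vectors, whose topology is the product topology. *)
Definition set_power (R : realType) (D : set R[i]) (j : nat) :
    set 'rV[R[i]]_j :=
  [set v | forall k, D (v ord0 k)].

Arguments set_power {R} D j _.

(* Main.v *)
(* Part (a). For every finite window [K], the group is partitioned into finite
   cells of bounded size such that, for most [x], the set [K * x] lies in the
   cell of [x]. If a point [x_A] of the system is attached to each cell [A] and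
   [z g := f (T g x_A)] for [g] in [A], then most local patterns of [z] are
   patterns of orbits. Within each cell of a much coarser partition the points
   [x_A] are chosen one after the other so that the deviations of the pattern
   frequencies from their expectations nearly cancel, as they would do for
   independent random points. Gluing such constructions for growing windows
   along a sequence of finite subsets of [G] that increases slowly with respect
   to [F] gives a single [z], with no passage to a subsequence of [F].

   Part (b). Fix a nonprincipal ultrafilter [U] on [nat]. The system is the
   space of sequences [x : nat -> G], where [G] acts by left multiplication,
   with the Loeb measure: the measure of [{x | A_N contains x_N, U-a.e. N}] is
   the limit along [U] of [|A_N meet F_N| / |F_N|]. Sigma-additivity is
   countable saturation and invariance is the Folner property. With
   [f x := lim_U z (x_N)], integrals are limits along [U] of averages. *)

Require Import Defs.
From HB Require Import structures.
From mathcomp Require Import all_boot all_order all_algebra finmap.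
From mathcomp Require Import complex ring lra zify.
From mathcomp Require Import all_classical all_reals all_analysis.
From mathcomp Require Import measurable_realfun.

Set Implicit Arguments.
Unset Strict Implicit.
Unset Printing Implicit Defensive.

Import Order.TTheory GRing.Theory Num.Theory.
Import numFieldNormedType.Exports.

Local Open Scope classical_set_scope.
Local Open Scope ring_scope.

(** * Finite sets and partitions of a group *)

(** In (a) neither ergodicity of the system nor any growth condition on [F] is given, so pointwise
    ergodic theorems and a single generic orbit are of no help; almost invariance of [F] is all
    there is. Windows act on the left, hence tiles are cut from right translates [T * g]: the left
    [K]-boundary of [T * g] is that of [T] moved by [g], so left invariance of [T] controls every
    tile. Independence is replaced by a second-moment bound. The sum of squared discrepancies grows
    linearly with the size of a coarse cell, so each discrepancy is of the order of a square root,
    negligible once the coarse cell is large compared with the number of events and the size of the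
    fine cells. Hence the two nested partitions: [gam] preserves patterns, [Gam] averages.
    Frequencies are prescribed for countably many Borel cylinder events, not for continuous
    functions. Continuous functions follow by uniform approximation, with no search for sets of null
    boundary. In (b) the limit along [U] of averages always equals the integral; existence of the
    ordinary limit identifies the two limits. *)

Section FiniteSets.
Variables (R : realType) (G : groupType).
Implicit Types (F Q A : {fset G}) (K B : seq G) (u v : G -> R).

Definition inside K Q x := all (fun k => (k * x)%g \in Q) K.

Lemma insideP K Q x :
  reflect (forall k, k \in K -> (k * x)%g \in Q) (inside K Q x).
Proof. exact: allP. Qed.

Lemma inside_sub K K' Q x : {subset K <= K'} -> inside K' Q x -> inside K Q x.
Proof. by move=> KK' /insideP H; apply/insideP => k /KK'; exact: H. Qed.

Lemma leq_card_inj (f : G -> G) A Q : injective f ->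
  (forall x, x \in A -> f x \in Q) -> (#|` A| <= #|` Q|)%N.
Proof.
move=> f_inj fAQ; have <- : size [seq f x | x <- A] = #|` A| by rewrite size_map.
apply: uniq_leq_size; first by rewrite map_inj_uniq ?fset_uniq.
by move=> _ /mapP[x xA ->]; exact: fAQ.
Qed.

Lemma size_inside K Q x : uniq K -> inside K Q x -> (size K <= #|` Q|)%N.
Proof.
move=> uK /insideP KQ.
have <- : size [seq (k * x)%g | k <- K] = size K by rewrite size_map.
apply: uniq_leq_size; first by rewrite map_inj_uniq// => a b /mulIg.
by move=> _ /mapP[k kK ->]; exact: KQ.
Qed.

Lemma sumr1 F : \sum_(x <- F) 1 = #|` F|%:R :> R.
Proof. by rewrite big_const_seq count_predT iter_addr_0. Qed.

Lemma ler_sum_seq (s : seq G) u v : (forall x, x \in s -> u x <= v x) ->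
  \sum_(x <- s) u x <= \sum_(x <- s) v x.
Proof.
by move=> uv; rewrite [leLHS]big_seq [leRHS]big_seq; apply: ler_sum => x /uv.
Qed.

Lemma ler_sum_uniq (s t : seq G) u : uniq s -> uniq t ->
  (forall x, 0 <= u x) -> {subset s <= t} ->
  \sum_(x <- s) u x <= \sum_(x <- t) u x.
Proof.
move=> us ut u0 st; rewrite [leRHS](bigID (mem s))/= -[leLHS]addr0.
rewrite lerD//; last exact: sumr_ge0.
rewrite -[leRHS]big_filter (perm_big [seq x <- t | x \in s])//.
apply: uniq_perm => //; first exact: filter_uniq.
by move=> x; rewrite mem_filter; case: (boolP (x \in s)) => // /st ->.
Qed.

Lemma sum_indic F (P : pred G) :
  \sum_(x <- F) (P x)%:R = #|` [fset x in F | P x]%fset|%:R :> R.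
Proof.
rewrite -sumr1 (eq_bigr (fun x => if P x then 1 else 0)); last first.
  by move=> x _; case: (P x).
rewrite -big_mkcond -big_filter; apply: perm_big; apply: uniq_perm.
- exact/filter_uniq/fset_uniq.
- exact: fset_uniq.
- by move=> x; rewrite mem_filter !inE andbC.
Qed.

Lemma sum_translate F t u : (forall x, 0 <= u x) ->
  \sum_(c <- F | (t * c)%g \in F) u (t * c)%g <= \sum_(y <- F) u y.
Proof.
move=> u0; rewrite -big_filter -(big_map (fun c => t * c)%g predT u).
apply: ler_sum_uniq => //.
- rewrite map_inj_uniq; first exact/filter_uniq/fset_uniq.
  by move=> a b /mulgI.
- exact: fset_uniq.
- by move=> _ /mapP[c + ->]; rewrite mem_filter => /andP[].
Qed.

Lemma sum_shift F K k u : (forall x, 0 <= u x <= 1) -> k \in K ->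
  \sum_(x <- F) u (k * x)%g <=
    \sum_(x <- F) (~~ inside K F x)%:R + \sum_(x <- F) u x.
Proof.
move=> u01 kK; have u0 x : 0 <= u x by case/andP: (u01 x).
apply: le_trans (lerD (lexx _) (sum_translate F k u0)).
rewrite [X in _ <= _ + X]big_mkcond -big_split/=; apply: ler_sum => x _.
have [/insideP/(_ _ kK) ->|_] := boolP (inside K F x); first by rewrite add0r.
have /andP[ux0 ux1] := u01 (k * x)%g.
by case: ifP => _; rewrite ?addr0// lerDr.
Qed.

(** A partition is encoded by the map from points to cells, so that data can be attached to cells by
    functions on [{fset G}]. *)
Definition is_partition (tau : G -> {fset G}) :=
  (forall x, x \in tau x) /\ (forall x y, y \in tau x -> tau y = tau x).

(** The cell of [x] lies in the right translate [B * x]; thus [inside B F x] forces the whole cell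
    into [F]. *)
Definition bounded_by B (tau : G -> {fset G}) :=
  forall x y, y \in tau x -> (y * x^-1)%g \in B.

Lemma sum_fsetD A Q u : (A `<=` Q)%fset ->
  \sum_(g <- Q) u g = \sum_(g <- A) u g + \sum_(g <- (Q `\` A)%fset) u g.
Proof.
move=> AQ; rewrite (big_fsetID _ (mem A))/=; congr +%R; last first.
  by apply: eq_fbigl => y; rewrite !inE/= andbC.
apply: eq_fbigl => y; rewrite !inE/= andbC.
by case: (boolP (y \in A)) => //= /(fsubsetP AQ).
Qed.

Lemma card_fsetD A Q : (A `<=` Q)%fset ->
  #|` Q| = (#|` A| + #|` Q `\` A|%fset)%N.
Proof.
by move=> /fsetIidPr QA; rewrite -(cardfsID A Q) QA.
Qed.

Lemma partition_card_gt0 tau x : is_partition tau -> (0 < #|` tau x|)%N.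
Proof. by move=> [tau1 _]; rewrite cardfs_gt0; apply/fset0Pn; exists x. Qed.

Lemma saturatedD tau Q x : is_partition tau ->
  (forall y, y \in Q -> (tau y `<=` Q)%fset) ->
  forall y, y \in (Q `\` tau x)%fset -> (tau y `<=` Q `\` tau x)%fset.
Proof.
move=> [tau1 tau2] Qsat y; rewrite inE => /andP[ynx yQ].
apply/fsubsetP => w wy; rewrite inE (fsubsetP (Qsat _ yQ) _ wy) andbT.
by apply: contra ynx => wx; rewrite -(tau2 _ _ wx) (tau2 _ _ wy).
Qed.

(** Cells contained in [F] are peeled off one at a time, which keeps the remaining set a union of
    cells; points whose cell leaves [F] are estimated one by one by [M]. *)
Lemma sum_cells tau F u (M d : R) : is_partition tau -> 0 <= d ->
  (forall x, u x <= M) ->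
  (forall x, x \in F -> (tau x `<=` F)%fset ->
    \sum_(g <- tau x) u g <= d * #|` tau x|%:R) ->
  \sum_(g <- F) u g <=
    d * #|` F|%:R + M * \sum_(g <- F) (~~ (tau g `<=` F)%fset)%:R.
Proof.
move=> tauP d0 uM ucell.
have sat n Q : (#|` Q| < n)%N ->
    (forall x, x \in Q -> x \in F /\ (tau x `<=` F)%fset) ->
    (forall x, x \in Q -> (tau x `<=` Q)%fset) ->
    \sum_(g <- Q) u g <= d * #|` Q|%:R.
  elim: n Q => // n IH Q Qn QF Qsat.
  have [->|[x xQ]] := fset_0Vmem Q.
    by rewrite big_seq_fset0 cardfs0 mulr0.
  have tQ := Qsat _ xQ.
  rewrite (sum_fsetD _ tQ) (card_fsetD tQ) natrD mulrDr lerD//.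
    by have [? ?] := QF _ xQ; exact: ucell.
  apply: IH (saturatedD tauP Qsat) => [|y].
    rewrite -ltnS (leq_trans _ Qn)// ltnS (card_fsetD tQ) -add1n leq_add2r.
    exact: partition_card_gt0.
  by rewrite inE => /andP[_]; exact: QF.
pose Q := [fset x in F | (tau x `<=` F)%fset]%fset.
rewrite (big_fsetID _ (fun x => (tau x `<=` F)%fset))/= lerD//.
  apply: le_trans (sat #|` Q|.+1 Q _ _ _) _ => //.
  - by move=> x; rewrite !inE => /andP[].
  - move=> x; rewrite !inE => /andP[xF xQ]; apply/fsubsetP => y yx.
    by rewrite !inE (fsubsetP xQ _ yx)/= (tauP.2 _ _ yx).
  - rewrite ler_wpM2l// ler_nat; apply: fsubset_leq_card.
    by apply/fsubsetP => x; rewrite !inE => /andP[].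
rewrite sum_indic -sumr1 mulr_sumr; apply: ler_sum => x _; rewrite mulr1.
exact: uM.
Qed.

End FiniteSets.

(** * Asymptotic invariance and growth of Folner sets *)

Section FolnerSequences.
Variables (R : realType) (G : groupType) (F : nat -> {fset G}).
Hypothesis F_folner : left_folner R F.

Lemma folner_card_gt0 N : 0 < #|` F N|%:R :> R.
Proof. by rewrite ltr0n cardfs_gt0; exact: F_folner.1. Qed.

Lemma folner_inside (K : seq G) (eta : R) : 0 < eta -> \forall N \near \oo,
  \sum_(x <- F N) (~~ inside K (F N) x)%:R <= eta * #|` F N|%:R.
Proof.
elim: K eta => [|k K IH] eta eta0.
  by near=> N; rewrite big1 ?mulr_ge0// ltW.
have eta2 : 0 < eta / 2 by rewrite divr_gt0.
have /cvgrPdist_le/(_ _ eta2) near_k := F_folner.2 k.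
near=> N.
have Kle : \sum_(x <- F N) (~~ inside K (F N) x)%:R <= eta / 2 * #|` F N|%:R.
  by near: N; exact: IH.
have kle : \sum_(x <- F N) ((k * x)%g \notin F N)%:R <= eta / 2 * #|` F N|%:R.
  apply: (@le_trans _ _ (#|` fsymdiff (ltranslate k (F N)) (F N)|%:R)).
    rewrite sum_indic ler_nat.
    apply: (leq_card_inj (@mulgI G k)) => x; rewrite !inE/= => /andP[xF kxF].
    by rewrite kxF/=; apply/orP; left; apply/imfsetP; exists x.
  rewrite -ler_pdivrMr ?folner_card_gt0//.
  by apply: le_trans (ler_norm _) _; rewrite -normrN -sub0r; near: N; exact: near_k.
apply: (@le_trans _ _ (\sum_(x <- F N) (((k * x)%g \notin F N)%:R +
    (~~ inside K (F N) x)%:R))).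
  apply: ler_sum_seq => x _ /=; rewrite negb_and -natrD ler_nat.
  by case: (_ \notin _); case: (~~ _).
by rewrite big_split/= (splitr eta) mulrDl lerD.
Unshelve. all: end_near. Qed.

Hypothesis G_infinite : infinite_set [set: G].

Lemma exists_uniq_seq n : exists s : seq G, uniq s /\ size s = n.
Proof.
have [A AG An] := infinite_set_fset n G_infinite.
exists (take n A); split; first exact/take_uniq/fset_uniq.
by rewrite size_takel.
Qed.

(** If a list of [n] distinct elements moves some [x] only inside [F N], then [F N] has at least [n]
    points; almost invariance provides such an [x] for large [N]. *)
Lemma folner_card (C : R) : \forall N \near \oo, C <= #|` F N|%:R.
Proof.
have [s [us sn]] := exists_uniq_seq (Num.bound `|C|).
have h0 : 0 < 2^-1 :> R by rewrite invr_gt0.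
near=> N.
have : \sum_(x <- F N) (~~ inside s (F N) x)%:R <= 2^-1 * #|` F N|%:R :> R.
  by near: N; exact: folner_inside.
apply: contraTT; rewrite -!ltNge => CF.
rewrite big_seq (eq_bigr (fun=> 1)) => [|x xF].
  rewrite -big_seq sumr1 -[ltRHS]mul1r ltr_pM2r ?folner_card_gt0//.
  by rewrite invf_lt1 ?ltr1n.
suff -> : inside s (F N) x = false by [].
apply/negP => /(size_inside us); rewrite sn -(ler_nat R) leNgt => /negP; apply.
apply: lt_le_trans CF _; apply: le_trans (ler_norm _) _.
exact/ltW/archi_boundP.
Unshelve. all: end_near. Qed.

End FolnerSequences.

(** * Partitions into bounded cells with small boundary *)

Section GreedyTiling.
Variables (R : realType) (G : groupType).
Variables (K : seq G) (T : {fset G}) (e : nat -> G) (d : R).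
Hypothesis K_sym : forall k, k \in K -> (k^-1)%g \in K.
Hypothesis e_surj : forall g, exists k, e k = g.
Hypothesis d_gt0 : 0 < d.

Definition rtranslate (g : G) : {fset G} := [fset (t * g)%g | t in T]%fset.

(** Neighbours in [C], the part already tiled, do not count: such a separated pair is charged to the
    earlier tile. *)
Definition rel_boundary (C A : {fset G}) : {fset G} :=
  [fset x in A | has (fun k => ((k * x)%g \notin A) && ((k * x)%g \notin C)) K]%fset.

Definition small_boundary C A :=
  #|` rel_boundary C A|%:R <= d * #|` A|%:R.

(** What is left of the translate is accepted only if its relative boundary is small; a refused
    translate yields an empty tile. *)
Definition next_tile C g : {fset G} :=
  let A := (rtranslate g `\` C)%fset in
  if small_boundary C A then A else fset0.

Fixpoint covered k : {fset G} :=
  if k is k'.+1 then (next_tile (covered k') (e k') `|` covered k')%fset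
  else fset0.

Definition tile k := next_tile (covered k) (e k).

Lemma next_tile_sub C g : (next_tile C g `<=` rtranslate g)%fset.
Proof.
by rewrite /next_tile; case: ifP => _; [exact: fsubsetDl|exact: fsub0set].
Qed.

Lemma next_tile_disj C g x : x \in next_tile C g -> x \notin C.
Proof.
by rewrite /next_tile; case: ifP => _; rewrite inE // => /andP[].
Qed.

Lemma next_tile_small C g : small_boundary C (next_tile C g).
Proof.
rewrite /next_tile; case: ifP => // _; rewrite /small_boundary cardfs0 mulr0.
rewrite (_ : rel_boundary _ _ = fset0) ?cardfs0//.
by apply/fsetP => x; rewrite !inE.
Qed.

Lemma tile_covered i k x : (i < k)%N -> x \in tile i -> x \in covered k.
Proof.
elim: k => // k IH; rewrite ltnS leq_eqVlt => /predU1P[->|ik] xi /=.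
  by rewrite inE xi.
by rewrite inE (IH ik xi) orbT.
Qed.

Lemma coveredP k x : x \in covered k -> exists2 i, (i < k)%N & x \in tile i.
Proof.
elim: k => // k IH /=; rewrite inE => /orP[xk|/IH[i ik xi]]; first by exists k.
by exists i => //; exact: ltnW.
Qed.

Lemma tile_inj i j x : x \in tile i -> x \in tile j -> i = j.
Proof.
move=> xi xj; case: (ltngtP i j) => // ij.
- by have := tile_covered ij xi; rewrite (negbTE (next_tile_disj xj)).
- by have := tile_covered ij xj; rewrite (negbTE (next_tile_disj xi)).
Qed.

Definition tiled x := exists k, x \in tile k.

Definition cell (x : G) : {fset G} :=
  if pselect (tiled x) is left t then tile (projT1 (cid t)) else [fset x]%fset.

Lemma cell_tile k x : x \in tile k -> cell x = tile k.
Proof.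
move=> xk; rewrite /cell; case: pselect => [t|[]]; last by exists k.
by congr tile; apply: tile_inj xk; exact: projT2 (cid t).
Qed.

Lemma cell_untiled x : ~ tiled x -> cell x = [fset x]%fset.
Proof. by rewrite /cell; case: pselect. Qed.

Lemma cell_partition : is_partition cell.
Proof.
split=> [x|x y].
  have [[k xk]|tx] := pselect (tiled x); first by rewrite (cell_tile xk).
  by rewrite cell_untiled// inE.
have [[k xk]|tx] := pselect (tiled x).
  by rewrite (cell_tile xk) => /cell_tile.
by rewrite cell_untiled// inE => /eqP ->; rewrite cell_untiled.
Qed.

Definition cell_bound : seq G :=
  1%g :: [seq (s * t^-1)%g | s <- enum_fset T, t <- enum_fset T].

Lemma cell_bounded : bounded_by cell_bound cell.
Proof.
move=> x y; have [[k xk]|tx] := pselect (tiled x); last first.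
  by rewrite cell_untiled// inE => /eqP ->; rewrite mulgV inE eqxx.
rewrite (cell_tile xk) => yk.
have /imfsetP[/= s sT ->] := fsubsetP (next_tile_sub _ _) _ xk.
have /imfsetP[/= t tT ->] := fsubsetP (next_tile_sub _ _) _ yk.
rewrite inE; apply/orP; right; apply/allpairsP; exists (t, s) => /=.
by split => //; rewrite invgM mulgA mulgK.
Qed.

Definition on_boundary x :=
  `[< exists k, x \in rel_boundary (covered k) (tile k) >].

Lemma on_boundary_cell x :
  \sum_(g <- cell x) (on_boundary g)%:R <= d * #|` cell x|%:R.
Proof.
have rb k y : y \in rel_boundary (covered k) (tile k) -> y \in tile k.
  by rewrite !inE => /andP[].
have [[k xk]|tx] := pselect (tiled x); last first.
  rewrite cell_untiled// big_seq_fset1 cardfs1 mulr1.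
  rewrite (_ : on_boundary x = false) ?ltW//.
  by apply/negbTE/asboolPn => -[k /rb xk]; apply: tx; exists k.
rewrite (cell_tile xk) sum_indic.
apply: le_trans (next_tile_small (covered k) (e k)).
rewrite ler_nat; apply: fsubset_leq_card; apply/fsubsetP => y.
rewrite !inE/= => /andP[yk /asboolP[i yi]].
by have := yi; rewrite (tile_inj (rb _ _ yi) yk) !inE.
Qed.

(* A pair [x], [k * x] separated by the tiling is charged to the endpoint that
   was tiled first, where it belongs to the relative boundary. *)
Lemma not_inside_cell x : tiled x -> ~~ inside K (cell x) x ->
  on_boundary x || has (fun k => on_boundary (k * x)%g) K.
Proof.
move=> [i xi]; rewrite (cell_tile xi) => /allPn[k kK kx].
have [kxC|kxC] := boolP ((k * x)%g \in covered i); last first.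
  apply/orP; left; apply/asboolP; exists i; rewrite !inE/= xi/=.
  by apply/hasP; exists k => //; rewrite kx.
have [j ji kxj] := coveredP kxC.
apply/orP; right; apply/hasP; exists k => //; apply/asboolP; exists j.
rewrite !inE/= kxj/=; apply/hasP; exists (k^-1)%g; first exact: K_sym.
rewrite mulKg; apply/andP; split.
  by apply/negP => /tile_inj/(_ xi) E; rewrite E ltnn in ji.
apply: contra (next_tile_disj xi) => /coveredP[m mj xm].
by apply: tile_covered xm; exact: ltn_trans ji.
Qed.

(** If the rest [A] of [T * g] is accepted, all of [T * g] is tiled. If it is refused, its relative
    boundary exceeds [d * #|A|]; but a neighbour outside both [A] and the covered part lies outside
    [T * g], so this boundary is at most that of [T]. Hence the untiled part, contained in [A], is
    small. *)
Lemma untiled_density (c : R) g :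
  \sum_(x <- T) (~~ inside K T x)%:R <= c * #|` T|%:R ->
  d * \sum_(t <- T) (~~ `[< tiled (t * g)%g >])%:R <= c * #|` T|%:R.
Proof.
move=> Tc; have [k kg] := e_surj g.
set A := (rtranslate g `\` covered k)%fset.
have card_le (P : pred G) (B : {fset G}) :
    (forall t, t \in T -> P t -> (t * g)%g \in B) ->
    \sum_(t <- T) (P t)%:R <= #|` B|%:R :> R.
  move=> H; rewrite sum_indic ler_nat.
  apply: (leq_card_inj (@mulIg G g)) => x; rewrite !inE/= => /andP[].
  exact: H.
have [small|large] := boolP (small_boundary (covered k) A).
  rewrite big_seq big1 ?mulr0.
    by apply: le_trans Tc; apply: sumr_ge0.
  move=> t tT; suff -> : `[< tiled (t * g)%g >] by [].
    apply/asboolP.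
  have tg : (t * g)%g \in rtranslate g by apply/imfsetP; exists t.
  have [/coveredP[i _ ?]|tgC] := boolP ((t * g)%g \in covered k).
    by exists i.
  by exists k; rewrite /tile kg /next_tile /= small inE tgC.
apply: (@le_trans _ _ (d * #|` A|%:R)).
  rewrite ler_pM2l//; apply: card_le => // t tT /asboolPn tg.
  rewrite in_fsetD; apply/andP; split; last by apply/imfsetP; exists t.
  by apply/negP => /coveredP[i _ ti]; apply: tg; exists i.
move: large; rewrite /small_boundary -ltNge => /ltW/le_trans; apply.
apply: le_trans Tc; rewrite sum_indic ler_nat.
apply: (leq_card_inj (@mulIg G g^-1%g)) => x; rewrite !inE/=.
move=> /andP[/andP[xC /imfsetP[/= t tT ->]]] /hasP[h hK].
rewrite !inE => /andP[htA htC]; rewrite mulgK tT/=; apply/allPn; exists h => //.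
apply: contra htA => ht; rewrite htC/= mulgA.
by apply/imfsetP; exists (h * t)%g.
Qed.

End GreedyTiling.

(** * Density of the tiling along the Folner sequence *)

Section HyperfinitePartition.
Variables (R : realType) (G : groupType) (F : nat -> {fset G}).
Hypothesis F_folner : left_folner R F.
Hypothesis G_countable : countable [set: G].

Lemma exists_enum : exists e : nat -> G, forall g, exists k, e k = g.
Proof.
have /countable_injP[f f_inj] := G_countable.
exists (fun k => xget 1%g [set g | f g = k]) => g; exists (f g).
case: xgetP => [h _ /= fh|/(_ g)/(_ erefl)//].
by apply: f_inj => //; rewrite inE.
Qed.

(* The sum over [T] and [Q] is the number of pairs [(t, c)] with [t * c] in
   [W], so averaging the hypothesis over [c] bounds the density of [W]. *)
Lemma translate_density (T Q : {fset G}) (W : pred G) (c : R) :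
  (forall g, \sum_(t <- T) (W (t * g)%g)%:R <= c * #|` T|%:R) ->
  (0 < #|` T|)%N ->
  \sum_(x <- Q) (W x)%:R <= c * #|` Q|%:R +
    \sum_(x <- Q) (~~ inside [seq (t^-1)%g | t <- enum_fset T] Q x)%:R.
Proof.
move=> Wc T0; set iT := [seq _ | _ <- _].
have T0' : 0 < #|` T|%:R :> R by rewrite ltr0n.
rewrite -(ler_pM2l T0') mulrDr.
apply: (@le_trans _ _ (\sum_(x <- Q) (\sum_(t <- T | (t^-1 * x)%g \in Q) (W x)%:R +
   #|` T|%:R * (~~ inside iT Q x)%:R))).
  rewrite mulr_sumr; apply: ler_sum => x _.
  have [|xQ] := boolP (inside iT Q x); last first.
    rewrite -[leLHS]add0r lerD ?sumr_ge0// ler_pM2l//.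
    by case: (W x).
  move=> /insideP xQ; rewrite mulr0 addr0 -sumr1 mulr_suml.
  under eq_bigr do rewrite mul1r.
  rewrite [leLHS]big_seq [leRHS]big_seq_cond.
  rewrite (eq_bigl (fun t => (t \in T) && ((t^-1 * x)%g \in Q)))// => t.
  by case: (boolP (t \in T)) => //= tT; apply/esym/xQ/map_f.
rewrite big_split/= -mulr_sumr lerD2r.
have -> : \sum_(x <- Q) \sum_(t <- T | (t^-1 * x)%g \in Q) (W x)%:R =
    \sum_(t <- T) \sum_(x <- Q | (t^-1 * x)%g \in Q) (W (t * (t^-1 * x)%g)%g)%:R :> R.
  rewrite (exchange_big_dep predT)//=; apply: eq_bigr => t _.
  by apply: eq_bigr => x _; rewrite mulVKg.
apply: (@le_trans _ _ (\sum_(t <- T) \sum_(y <- Q) (W (t * y)%g)%:R)).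
  apply: ler_sum => t _.
  exact: (sum_translate Q (t^-1)%g (u := fun y => (W (t * y)%g)%:R)).
rewrite exchange_big/=.
apply: le_trans (ler_sum _ (fun g _ => Wc g)) _.
under eq_bigr do rewrite -[c * _]mulr1.
by rewrite -mulr_sumr sumr1 mulrAC mulrC.
Qed.

Lemma hyperfinite_partition (K : seq G) (eps : R) : 0 < eps ->
  exists (tau : G -> {fset G}) (B : seq G),
    [/\ is_partition tau, bounded_by B tau &
      \forall N \near \oo, \sum_(x <- F N) (~~ inside K (tau x) x)%:R <=
        eps * #|` F N|%:R].
Proof.
move=> eps0; have [e e_surj] := exists_enum.
(* Symmetry is required because a separated pair may be charged to [k * x], whose neighbour [x] is
   reached by the inverse of [k]. *)
pose K' := K ++ [seq (k^-1)%g | k <- K].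
have K'sym k : k \in K' -> (k^-1)%g \in K'.
  rewrite !mem_cat => /orP[kK|/mapP[h hK ->]]; apply/orP.
    by right; exact: map_f.
  by left; rewrite invgK.
(* Error budget: [eps / 4 + d] for untiled points, [2 * d] for boundary points, [3 * d] for each of
   their [n] shifts; the total [eps / 4 + 3 * (n + 1) * d] is [eps]. *)
pose n := size K'; pose d : R := eps / (4 * n.+1%:R).
have d0 : 0 < d by rewrite divr_gt0// mulr_gt0.
have eps4 : 0 < eps / 4 by rewrite divr_gt0.
(* The extra factor [d] in the tolerance pays for the one lost in [untiled_density]. *)
have [N0 _ /(_ N0 (leqnn _)) TK] := folner_inside F_folner K' (mulr_gt0 d0 eps4).
pose T := F N0.
have T0 : (0 < #|` T|)%N by rewrite cardfs_gt0; exact: F_folner.1.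
pose tau := cell K' T e d; pose B := cell_bound T.
pose iT := [seq (t^-1)%g | t <- enum_fset T].
exists tau, B; split; [exact: cell_partition|exact: cell_bounded|].
pose U x := ~~ `[< tiled K' T e d x >].
have Udens g : \sum_(t <- T) (U (t * g)%g)%:R <= eps / 4 * #|` T|%:R.
  rewrite -(ler_pM2l d0) mulrA; exact: untiled_density.
near=> N.
have FK : \sum_(x <- F N) (~~ inside K' (F N) x)%:R <= d * #|` F N|%:R.
  by near: N; exact: folner_inside.
have FB : \sum_(x <- F N) (~~ inside B (F N) x)%:R <= d * #|` F N|%:R.
  by near: N; exact: folner_inside.
have FT : \sum_(x <- F N) (~~ inside iT (F N) x)%:R <= d * #|` F N|%:R.
  by near: N; exact: folner_inside.
pose D x := on_boundary K' T e d x.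
have D_dens : \sum_(x <- F N) (D x)%:R <= (d + d) * #|` F N|%:R.
  have := @sum_cells R G tau (F N) (fun x => (D x)%:R) 1 d (cell_partition _ _ _ _) (ltW d0).
  move=> /(_ _ _)/le_trans; apply.
  - by move=> x; case: (D x).
  - by move=> x _ _; apply: on_boundary_cell.
  rewrite mulrDl mul1r lerD2l; apply: le_trans FB; apply: ler_sum => x _.
  rewrite ler_nat; case: (boolP (inside B (F N) x)) => [/insideP xB|_]; last exact: leq_b1.
  rewrite leqn0 eqb0 negbK; apply/fsubsetP => y yx.
  by rewrite -(mulgVK x y); apply: xB; exact: cell_bounded yx.
have kD k : k \in K' -> \sum_(x <- F N) (D (k * x)%g)%:R <=
    \sum_(x <- F N) (~~ inside K' (F N) x)%:R + (d + d) * #|` F N|%:R.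
  move=> kK; apply: le_trans (lerD (lexx _) D_dens).
  by apply: (@sum_shift R G _ K' k (fun x => (D x)%:R)) => // x; rewrite ler0n lern1 leq_b1.
apply: (@le_trans _ _ (\sum_(x <- F N) ((U x)%:R + ((D x)%:R +
    \sum_(k <- K') (D (k * x)%g)%:R)))).
  apply: ler_sum => x _; rewrite -natr_sum -!natrD ler_nat.
  case: (boolP (inside K (tau x) x)) => //= xK.
  rewrite /U; case: asboolP => [tx|] //=; rewrite add0n.
  have : ~~ inside K' (tau x) x.
    by apply: contra xK; apply: inside_sub => k kK; rewrite mem_cat kK.
  move=> /(not_inside_cell K'sym tx) /orP[|/hasP[k kK Dk]]; rewrite -/(D _).
    by move=> ->.
  by rewrite (big_rem k)//= /D Dk addnCA.
rewrite !big_split/= exchange_big/=.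
have Ule := translate_density (F N) Udens T0.
have sumD : \sum_(k <- K') \sum_(x <- F N) (D (k * x)%g)%:R <=
    n%:R * (3 * d * #|` F N|%:R).
  rewrite (_ : n%:R = \sum_(k <- K') 1); last first.
    by rewrite big_const_seq count_predT iter_addr_0.
  rewrite mulr_suml [leLHS]big_seq [leRHS]big_seq; apply: ler_sum => k kK.
  rewrite mul1r; apply: le_trans (kD _ kK) _.
  by move: FK; lra.
have dE : eps = 4 * n.+1%:R * d by rewrite /d mulrC divfK// mulf_neq0.
move: Ule FT sumD D_dens; rewrite dE -/iT -[n.+1%:R]natr1.
set a := \sum_(x <- _) _; set b := \sum_(x <- _) _.
set f := #|` F N|%:R; move=> *.
have : 0 <= d * f by rewrite mulr_ge0// ltW.
have : 0 <= n%:R * (d * f) by rewrite mulr_ge0// mulr_ge0// ltW.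
lra.
Unshelve. all: end_near. Qed.

End HyperfinitePartition.

(** * Integrals of bounded functions *)

Section Means.
Context {d : measure_display} (R : realType) (X : measurableType d).
Variable P : probability X R.
Implicit Types (u v : X -> R) (m : R).

Definition has_mean u m := [/\ measurable_fun setT u,
  exists M, forall x, `|u x| <= M & \int[P]_x u x = m].

Lemma has_mean_integrable u m : has_mean u m -> P.-integrable setT (EFin \o u).
Proof.
move=> [mu [M uM] _]; apply: measurable_bounded_integrable => //.
  by apply: le_lt_trans (probability_le1 P measurableT) _; rewrite ltry.
exists M; split; first exact: num_real.
by move=> N MN x _ /=; exact: le_trans (uM x) (ltW MN).
Qed.

Lemma has_mean_cst m : has_mean (fun=> m) m.
Proof.
split; first exact: measurable_cst.
  by exists `|m|.
rewrite Rintegral_cst// (_ : fine _ = 1) ?mulr1//.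
by rewrite (_ : _ setT = 1%E)//; exact: probability_setT.
Qed.

Lemma has_mean_indic (A : set X) : measurable A ->
  has_mean (fun x => (`[< A x >])%:R) (fine (P A)).
Proof.
move=> mA.
have -> : (fun x => (`[< A x >])%:R) = \1_A :> (X -> R).
  by apply/funext => x; rewrite indicE; case: asboolP => Ax; [rewrite mem_set|rewrite memNset].
split; first exact: measurable_indic.
  by exists 1 => x; rewrite indicE normr_nat lern1 leq_b1.
by rewrite /Rintegral integral_indic// setIT.
Qed.

Lemma fine_probability_le1 (A : set X) : measurable A ->
  0 <= fine (P A) <= 1.
Proof.
move=> mA; rewrite fine_ge0//=.
by rewrite -lee_fin fineK ?probability_le1 ?fin_num_measure.
Qed.

Lemma has_meanD u v m m' : has_mean u m -> has_mean v m' ->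
  has_mean (fun x => u x + v x) (m + m').
Proof.
move=> hu hv; have iu := has_mean_integrable hu; have iv := has_mean_integrable hv.
case: hu hv => mu [M uM] um [mv [N vN] vm]; split.
- exact: measurable_funD.
- exists (M + N) => x; exact: le_trans (ler_normD _ _) (lerD _ _).
- by rewrite RintegralD// um vm.
Qed.

Lemma has_meanZ u m c : has_mean u m -> has_mean (fun x => c * u x) (c * m).
Proof.
move=> hu; have iu := has_mean_integrable hu.
case: hu => mu [M uM] um; split.
- exact: measurable_funM.
- by exists (`|c| * M) => x; rewrite normrM ler_wpM2l.
- by rewrite RintegralZl// um.
Qed.

Lemma has_mean_sum (I : Type) (r : seq I) (u : I -> X -> R) (m : I -> R) :
  (forall i, has_mean (u i) (m i)) ->
  has_mean (fun x => \sum_(i <- r) u i x) (\sum_(i <- r) m i).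
Proof.
move=> um; elim: r => [|i r IH].
  rewrite big_nil (_ : (fun _ => _) = fun=> 0); first exact: has_mean_cst.
  by apply/funext => x; rewrite big_nil.
rewrite big_cons (_ : (fun _ => _) = fun x => u i x + \sum_(j <- r) u j x).
  exact: has_meanD.
by apply/funext => x; rewrite big_cons.
Qed.

Lemma has_mean_le u v m m' : has_mean u m -> has_mean v m' ->
  (forall x, u x <= v x) -> m <= m'.
Proof.
move=> hu hv uv; have iu := has_mean_integrable hu; have iv := has_mean_integrable hv.
by case: hu hv => _ _ <- [_ _ <-]; apply: le_Rintegral.
Qed.

(** This replaces the random choice of a point. *)
Lemma exists_le_mean u m e : has_mean u m -> 0 < e -> exists x, u x <= m + e.
Proof.
move=> um e0; apply: contrapT => /forallNP H.
have : m + e <= m.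
  apply: (has_mean_le (has_mean_cst (m + e)) um) => x.
  by rewrite leNgt; apply/negP => /ltW; exact: H.
by rewrite gerDl leNgt e0.
Qed.

(** Measurability of [u] is part of the conclusion: it is a uniform limit of measurable functions,
    and the approximant at distance 1 bounds it. *)
Lemma has_mean_approx u :
  (forall e, 0 < e -> exists v m, has_mean v m /\ forall x, `|u x - v x| <= e) ->
  has_mean u (\int[P]_x u x).
Proof.
move=> approx; split=> //; last first.
  have [v [m [[_ [M vM] _]] uv]] := approx 1 ltr01.
  exists (1 + M) => x; rewrite -[u x](subrK (v x)).
  exact: le_trans (ler_normD _ _) (lerD (uv x) (vM x)).
have [v_ v_P] : {v : nat -> X -> R & forall n, measurable_fun setT (v n) /\
    forall x, `|u x - v n x| <= n.+1%:R^-1}.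
  apply: (@choice _ _ (fun n v => measurable_fun setT v /\
    forall x, `|u x - v x| <= n.+1%:R^-1)) => n.
  have [|v [m [[mv _ _] uv]]] := approx n.+1%:R^-1; first by rewrite invr_gt0 ltr0n.
  by exists v.
apply: (measurable_fun_cvg (h := v_)) => [n|x _]; first by have [] := v_P n.
apply/cvgrPdist_le => e e0.
near=> n; apply: le_trans ((v_P n).2 x) _; apply: ltW; near: n.
exact: near_infty_natSinv_lt (PosNum e0).
Unshelve. all: end_near. Qed.

Lemma has_mean_dist u v m m' e : has_mean u m -> has_mean v m' ->
  (forall x, `|u x - v x| <= e) -> `|m - m'| <= e.
Proof.
move=> hu hv uv; rewrite ler_norml; apply/andP; split.
  rewrite lerNl opprB lerBlDr addrC.
  apply: has_mean_le hv (has_meanD hu (has_mean_cst e)) _ => x.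
  by have := uv x; rewrite ler_norml => /andP[]; lra.
rewrite lerBlDr addrC.
apply: has_mean_le hu (has_meanD hv (has_mean_cst e)) _ => x.
by have := uv x; rewrite ler_norml => /andP[]; lra.
Qed.

End Means.

(** * Selection of orbit pieces *)

Section Selection.
Context {d : measure_display} (R : realType) (G : groupType).
Variables (X : measurableType d) (P : probability X R) (T : G -> X -> X).
Hypothesis T_mpa : measure_preserving_action P T.

Lemma has_mean_translate (A : set X) g : measurable A ->
  has_mean P (fun x => (`[< A (T g x) >])%:R) (fine (P A)).
Proof.
move=> mA; rewrite -(mpa_preserving T_mpa g mA).
apply: (has_mean_indic P (A := T g @^-1` A)).
by rewrite -[X in measurable X]setTI; exact: mpa_measurable T_mpa g _ _ _.
Qed.

(** Where [y] is constant on a cell, the points [T g (y g)] run through a piece of one orbit. *)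
Definition discrepancy (A : set X) (y : G -> X) (S : {fset G}) : R :=
  \sum_(g <- S) ((`[< A (T g (y g)) >])%:R - fine (P A)).

Lemma discrepancy_bound A y S : measurable A ->
  `|discrepancy A y S| <= #|` S|%:R.
Proof.
move=> mA; apply: le_trans (ler_norm_sum _ _ _) _.
rewrite -sumr1; apply: ler_sum => g _.
have /andP[p0 p1] := fine_probability_le1 P mA.
by rewrite ler_norml; case: `[< _ >] => /=; apply/andP; split; lra.
Qed.

(* The points are chosen one cell at a time. The new contributions have mean
   zero, so a point can be chosen which makes a nearly nonpositive scalar
   product with the current discrepancies; the sum of squares then grows by
   at most a constant. *)
Lemma select_points (n : nat) (Om : nat -> set X) (gam : G -> {fset G})
    (b : nat) (S : {fset G}) :
  (forall i, measurable (Om i)) -> is_partition gam ->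
  (forall x, x \in S -> #|` gam x| <= b)%N ->
  (forall x, x \in S -> (gam x `<=` S)%fset) ->
  exists y : {fset G} -> X,
    \sum_(i < n) discrepancy (Om i) (y \o gam) S ^+ 2 <=
      (n%:R * b%:R ^+ 2 + 1) * #|` S|%:R.
Proof.
move=> mOm gamP.
have [m] := ubnP #|` S|; elim: m S => // m IH S Sm gamb Ssat.
have [->|[x xS]] := fset_0Vmem S.
  exists (fun=> point); rewrite cardfs0 mulr0 big1// => i _.
  by rewrite /discrepancy big_seq_fset0 expr0n.
have gS := Ssat _ xS; pose S' := (S `\` gam x)%fset.
have [||y yS'] := IH S' _ _ (saturatedD gamP Ssat).
- rewrite -ltnS (leq_trans _ Sm)// ltnS (card_fsetD gS) -add1n leq_add2r.
  exact: partition_card_gt0.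
- by move=> w; rewrite inE => /andP[_]; exact: gamb.
pose D (i : 'I_n) := discrepancy (Om i) (y \o gam) S'.
(* Since each [T g] preserves [P], every new contribution has mean zero whatever the old
   discrepancies [D i] are. *)
have vmean : has_mean P (fun z => \sum_(i < n)
   D i * discrepancy (Om i) (fun=> z) (gam x)) (\sum_(i < n) D i * 0).
  apply: has_mean_sum => i; apply: has_meanZ.
  rewrite (_ : 0 = \sum_(g <- gam x) (fine (P (Om i)) + - fine (P (Om i)))).
    apply: has_mean_sum => g; apply: has_meanD; first exact: has_mean_translate.
    exact: has_mean_cst.
  by rewrite big1// => g _; rewrite subrr.
(* The cross term is doubled in the square, so a slack of [1/2] contributes the [+ 1] of the
   bound. *)
have h2 : 0 < 2^-1 :> R by rewrite invr_gt0.
have [z] := exists_le_mean vmean h2.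
rewrite [X in _ <= X + _]big1 => [|i _]; last by rewrite mulr0.
rewrite add0r => zle.
exists (fun A => if A == gam x then z else y A).
have split_disc (i : 'I_n) : discrepancy (Om i)
      ((fun A => if A == gam x then z else y A) \o gam) S =
    discrepancy (Om i) (fun=> z) (gam x) + D i.
  rewrite /discrepancy (sum_fsetD _ gS); congr +%R.
    rewrite big_seq [RHS]big_seq; apply: eq_bigr => g gx.
    by rewrite /= (gamP.2 _ _ gx) eqxx.
  rewrite big_seq [RHS]big_seq; apply: eq_bigr => g; rewrite inE => /andP[gx _] /=.
  by case: eqP => // E; rewrite -E gamP.1 in gx.
under eq_bigr do rewrite split_disc sqrrD.
rewrite !big_split/= (card_fsetD gS) natrD mulrDr lerD//.
have Zle : \sum_(i < n) discrepancy (Om i) (fun=> z) (gam x) ^+ 2 <=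
    n%:R * b%:R ^+ 2.
  rewrite mulr_natl -[in leRHS](card_ord n) -sumr_const; apply: ler_sum => i _.
  rewrite -real_normK ?num_real// ler_pXn2r ?nnegrE//.
  by apply: le_trans (discrepancy_bound _ _ (mOm (nat_of_ord i))) _; rewrite ler_nat gamb.
have c1 : 1 <= #|` gam x|%:R :> R by rewrite ler1n partition_card_gt0.
have nb : 0 <= n%:R * b%:R ^+ 2 :> R by rewrite mulr_ge0// exprn_ge0.
apply: le_trans (_ : n%:R * b%:R ^+ 2 + 1 <= _); last first.
  by rewrite ler_peMr// addr_ge0.
apply: lerD => //.
under eq_bigr do rewrite mulrC.
by move: zle; lra.
Qed.

End Selection.

(** * Gluing partitions of growing windows *)

Section MultiscalePartition.
Variables (R : realType) (G : groupType) (F : nat -> {fset G}).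
Hypothesis F_folner : left_folner R F.
Hypothesis G_countable : countable [set: G].
Hypothesis G_infinite : infinite_set [set: G].

Lemma bounded_by_card B tau (x : G) : bounded_by B tau ->
  (#|` tau x| <= size B)%N.
Proof.
move=> tauB.
have <- : size [seq (y * x^-1)%g | y <- tau x] = #|` tau x| by rewrite size_map.
apply: uniq_leq_size; first by rewrite map_inj_uniq ?fset_uniq// => a b /mulIg.
by move=> _ /mapP[y yx ->]; exact: tauB.
Qed.

Lemma bigmax_seq_attained (s : seq G) (f : G -> nat) x0 : x0 \in s ->
  exists2 x, x \in s & f x = (\max_(y <- s) f y)%N.
Proof.
elim: s x0 => // a [|b s] IH x0 _.
  by exists a; rewrite ?inE// big_seq1.
have [x xs fx] := IH b (mem_head _ _).
rewrite big_cons -fx; case: (leqP (f x) (f a)) => fxa.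
  by exists a; rewrite ?mem_head.
by exists x => //; rewrite (in_cons a) xs orbT.
Qed.

Definition saturation (tau : G -> {fset G}) (A : {fset G}) : {fset G} :=
  (\bigcup_(x <- A) tau x)%fset.

Lemma saturationP tau A y :
  reflect (exists2 x, x \in A & y \in tau x) (y \in saturation tau A).
Proof.
apply: (iffP (bigfcupP _ _ _ _)) => [[x /andP[xA _] yx]|[x xA yx]]; exists x => //.
by rewrite xA.
Qed.

(* Partitions adapted to larger and larger windows are glued along an exhaustion
   of [G] by finite sets that grow slowly compared with the index [N]; the level
   [lev x] records which partitions are in force at [x]. *)
Lemma multiscale_partition (W : nat -> seq G) (L : nat -> nat -> nat) :
  (forall n, {subset W n <= W n.+1}) ->
  exists (lev : G -> nat) (gam Gam : G -> {fset G}) (b : nat -> nat),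
  [/\ is_partition gam, is_partition Gam, forall x, (gam x `<=` Gam x)%fset,
      forall x y, y \in Gam x -> lev y = lev x &
      (forall x, #|` gam x| <= b (lev x))%N /\
      forall n eps, 0 < eps -> \forall N \near \oo,
        \sum_(x <- F N) (~~ [&& (n <= lev x)%N,
          (L (lev x) (b (lev x)) <= #|` Gam x|)%N, (Gam x `<=` F N)%fset &
          inside (W n) (gam x) x])%:R <= eps * #|` F N|%:R :> R].
Proof.
move=> Wmono; have [e e_surj] := exists_enum G_countable.
have [big bigP] := choice (exists_uniq_seq G_infinite).
pose ep n : R := n.+1%:R^-1.
have ep0 n : 0 < ep n by rewrite invr_gt0.
have ep_le m n : (m <= n)%N -> ep n <= ep m.
  by move=> mn; rewrite lef_pV2 ?posrE// ler_nat.
(* Partitions are chosen beforehand for every window and tolerance, because the window of each level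
   depends on the cell bound of the previous one. *)
have [tauB tauBP] := choice (fun p : seq G * nat =>
  let: ex_intro t (ex_intro B H) :=
    hyperfinite_partition F_folner G_countable p.1 (ep0 p.2) in
  ex_intro (fun q : (G -> {fset G}) * seq G =>
    [/\ is_partition q.1, bounded_by q.2 q.1 &
      \forall N \near \oo, \sum_(x <- F N) (~~ inside p.1 (q.1 x) x)%:R <=
        ep p.2 * #|` F N|%:R]) (t, B) H).
(* The list [big] has prescribed length and distinct entries: a cell containing its translate by [x]
   has at least that many points. This gives the lower bound [L] on the coarse cells. *)
pose fix K n := if n is m.+1 then
  K m ++ W m.+1 ++ big (L m (size (tauB (K m, m)).2)) else W 0%N.
pose tau n := (tauB (K n, n)).1; pose B n := (tauB (K n, n)).2.
have tauP n : is_partition (tau n) by case: (tauBP (K n, n)).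
have tauBd n : bounded_by (B n) (tau n) by case: (tauBP (K n, n)).
have Kmono m n : (m <= n)%N -> {subset K m <= K n}.
  elim: n => [|n IH]; first by rewrite leqn0 => /eqP ->.
  rewrite leq_eqVlt => /predU1P[->//|/IH mn x /mn xn].
  by rewrite /= mem_cat xn.
have KW n : {subset W n <= K n}.
  by case: n => [//|n] x xW; rewrite /= !mem_cat xW orbT.
have Wmono' m n : (m <= n)%N -> {subset W m <= W n}.
  elim: n => [|n IH]; first by rewrite leqn0 => /eqP ->.
  by rewrite leq_eqVlt => /predU1P[->//|/IH mn x /mn /Wmono].
have Kbig n : {subset big (L n (size (B n))) <= K n.+1}.
  by move=> x xb; rewrite /= !mem_cat xb !orbT.
(* Outside [E n] the set [F N] will meet only levels [n] and [n.+1]. Level [l] uses [tau] at [l],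
   [l.+1], [l.+2], whence four partitions; its coarse cells are bounded by [B l.+1], whence two
   bounds. *)
pose good n (E : {fset G}) N := [/\ forall m, (m < 4)%N ->
    \sum_(x <- F N) (~~ inside (K (n + m)%N) (tau (n + m)%N x) x)%:R <=
      ep n * #|` F N|%:R,
    \sum_(x <- F N) (~~ inside (B n.+1 ++ B n.+2) (F N) x)%:R <=
      ep n * #|` F N|%:R &
    #|` E|%:R <= ep n * #|` F N|%:R].
have [NN NNP] : {NN : nat * {fset G} -> nat & forall p N, (NN p <= N)%N ->
    good p.1 p.2 N}.
  apply: (@choice _ _ (fun p NN => forall N, (NN <= N)%N -> good p.1 p.2 N)).
  move=> [n E] /=.
  have [M _ HM] : \forall N \near \oo, good n E N.
    have tau_near m : \forall N \near \oo,
        \sum_(x <- F N) (~~ inside (K (n + m)%N) (tau (n + m)%N x) x)%:R <=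
        ep n * #|` F N|%:R.
      have [_ _ H] := tauBP (K (n + m)%N, (n + m)%N).
      near=> N; apply: (@le_trans _ _ (ep (n + m)%N * #|` F N|%:R)).
        by near: N; exact: H.
      by rewrite ler_wpM2r// ep_le// leq_addr.
    near=> N; split.
    - have h0 : \sum_(x <- F N) (~~ inside (K (n + 0)%N) (tau (n + 0)%N x) x)%:R <=
        ep n * #|` F N|%:R by near: N; exact: (tau_near 0%N).
      have h1 : \sum_(x <- F N) (~~ inside (K (n + 1)%N) (tau (n + 1)%N x) x)%:R <=
        ep n * #|` F N|%:R by near: N; exact: (tau_near 1%N).
      have h2 : \sum_(x <- F N) (~~ inside (K (n + 2)%N) (tau (n + 2)%N x) x)%:R <=
        ep n * #|` F N|%:R by near: N; exact: (tau_near 2%N).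
      have h3 : \sum_(x <- F N) (~~ inside (K (n + 3)%N) (tau (n + 3)%N x) x)%:R <=
        ep n * #|` F N|%:R by near: N; exact: (tau_near 3%N).
      by case=> [|[|[|[|m]]]].
    - by near: N; exact: folner_inside.
    - rewrite -ler_pdivrMl//; near: N; exact: folner_card.
  by exists M => N; exact: HM.
(* [E n] is a union of cells of [tau n.+1], and it contains the finitely many
   [F N] that are not invariant enough for the partitions used outside it. *)
pose fix E n : {fset G} := if n is m.+1 then
  saturation (tau m.+2) (E m `|` \bigcup_(N <- iota 0 (NN (m, E m))) F N `|` [fset e m])%fset
  else fset0.
have in_sat n A x : x \in A -> x \in saturation (tau n) A.
  by move=> xA; apply/saturationP; exists x => //; exact: (tauP n).1.
have Emono m n : (m <= n)%N -> {subset E m <= E n}.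
  elim: n => [|n IH]; first by rewrite leqn0 => /eqP ->.
  rewrite leq_eqVlt => /predU1P[->//|/IH mn x /mn xn].
  by apply: in_sat; rewrite !inE xn.
have Esat n x y : x \in E n -> y \in tau n.+1 x -> y \in E n.
  case: n => [|n]; first by rewrite inE.
  move=> /saturationP[w wA xw] yx; apply/saturationP; exists w => //.
  by rewrite -((tauP _).2 _ _ xw).
have EF n N : (N < NN (n, E n))%N -> {subset F N <= E n.+1}.
  move=> NNn x xF; apply: in_sat; rewrite !inE; apply/orP; left; apply/orP; right.
  by apply/bigfcupP; exists N => //; rewrite mem_iota NNn.
have Ex x : exists n, x \in E n.+1.
  by have [n <-] := e_surj x; exists n; apply: in_sat; rewrite !inE eqxx orbT.
pose lev x := ex_minn (Ex x).
have levE n x : (x \in E n) = (lev x < n)%N.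
  rewrite /lev; case: ex_minnP => l xl lmin; apply/idP/idP.
    by case: n => [|n]; [rewrite inE|rewrite ltnS; exact: lmin].
  by move=> ln; exact: Emono xl.
(* Level [l] is [E l.+1] minus [E l], where [E l.+1] is a union of cells of [tau l.+2] and [E l] one
   of cells of [tau l.+1]. Intersecting the two cells keeps the level constant. *)
pose Gam x := (tau (lev x).+1 x `&` tau (lev x).+2 x)%fset.
pose gam x := (tau (lev x) x `&` Gam x)%fset.
have levG x y : y \in Gam x -> lev y = lev x.
  rewrite inE => /andP[y1 y2]; apply/eqP; rewrite eqn_leq; apply/andP; split.
    by rewrite -ltnS -levE; apply: Esat y2; rewrite levE.
  rewrite leqNgt -levE; apply/negP => yE.
  have : x \in E (lev x).
    by apply: Esat yE _; rewrite ((tauP _).2 _ _ y1); exact: (tauP _).1.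
  by rewrite levE ltnn.
exists lev, gam, Gam, (fun n => size (B n)); split.
- split=> [x|x y yx]; first by rewrite !inE !(tauP _).1.
  have := yx; rewrite inE => /andP[yx0 yG]; have ly := levG _ _ yG.
  move: yG; rewrite inE => /andP[yx1 yx2].
  by rewrite /gam /Gam ly !((tauP _).2 x y).
- split=> [x|x y yx]; first by rewrite !inE !(tauP _).1.
  have ly := levG _ _ yx; move: yx; rewrite inE => /andP[yx1 yx2].
  by rewrite /Gam ly !((tauP _).2 x y).
- by move=> x; exact: fsubsetIr.
- exact: levG.
split=> [x|n0 eps eps0].
  apply: leq_trans (bounded_by_card x (tauBd (lev x))).
  by apply: fsubset_leq_card; exact: fsubsetIl.
(* Six errors of size [ep n]: one for [E n], four for the partitions, one for the boundary of
   [F N]. *)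
have [n1 n01 epn1] : exists2 n1, (n0 <= n1)%N & 6 * ep n1 <= eps.
  have [k kP] : exists k, 6 * ep k <= eps.
    exists (Num.bound (6 / eps)); rewrite /ep ler_pdivrMr ?ltr0n// mulrC.
    rewrite -ler_pdivrMr// ltW// (lt_trans (archi_boundP _)) ?divr_ge0 ?ltr_nat//.
    exact: ltW.
  exists (maxn n0 k); first exact: leq_maxl.
  by apply: le_trans kP; rewrite ler_wpM2l// ep_le// leq_maxr.
near=> N.
have EF_lt : #|` E n1.+1|%:R < #|` F N|%:R :> R.
  apply: (@lt_le_trans _ _ (#|` E n1.+1|%:R + 1)); first by rewrite ltrDl.
  by near: N; exact: folner_card.
have [x0 x0F x0E] : exists2 x, x \in F N & x \notin E n1.+1.
  apply/fsubsetPn; apply: contraTN EF_lt => /fsubset_leq_card.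
  by rewrite -(ler_nat R) leNgt.
pose mx := (\max_(x <- F N) lev x)%N.
have mx_le x : x \in F N -> (lev x <= mx)%N.
  by move=> xF; rewrite /mx (big_rem x)//= leq_maxl.
have [x1 x1F x1m] : exists2 x, x \in F N & lev x = mx.
  exact: bigmax_seq_attained x0F.
have [n n1n mxE] : exists2 n, (n1 <= n)%N & mx = n.+1.
  have : (n1 < mx)%N.
    by apply: leq_trans (mx_le _ x0F); rewrite ltnNge -ltnS -levE.
  by case: mx {mx_le x1m} => // n; rewrite ltnS => ?; exists n.
rewrite {}mxE in x1m mx_le.
(* [n.+1] is the largest level met by [F N], which therefore lies in
   [E n.+2] but not in [E n.+1]; the level is [n] or [n.+1] outside [E n]. *)
have [] : good n (E n) N.
  apply: (NNP (n, E n)); rewrite leqNgt; apply/negP => /EF/(_ _ x1F).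
  by rewrite levE x1m ltnn.
move=> gtau gB gE.
pose bad x : R := (x \in E n)%:R + (\sum_(m < 4)
  (~~ inside (K (n + m)%N) (tau (n + m)%N x) x)%:R +
  (~~ inside (B n.+1 ++ B n.+2) (F N) x)%:R).
apply: (@le_trans _ _ (\sum_(x <- F N) bad x)).
  apply: ler_sum_seq => x xF; rewrite /bad -natr_sum -!natrD ler_nat.
  have [_|xE] := boolP (x \in E n); first exact: leq_trans (leq_b1 _) (leq_addr _ _).
  have [xB|_] := boolP (inside (B _ ++ _) _ _); last first.
    by apply: leq_trans (leq_b1 _) _; rewrite addnA leq_addl.
  have [|/forallPn[m xm]] := boolP [forall m : 'I_4, inside (K (n + m)%N) (tau (n + m)%N x) x];
    last first.
    by apply: leq_trans (leq_b1 _) _; rewrite (bigD1 m)//= xm.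
  move=> /forallP xK; apply: leq_trans (leq0n _); rewrite leqn0 eqb0 negbK.
  have nl : (n <= lev x)%N by rewrite leqNgt -levE.
  have ln := mx_le _ xF.
  have Kl m : (m < 3)%N -> inside (K (lev x + m)%N) (tau (lev x + m)%N x) x.
    move=> m3; have m4 : (lev x - n + m < 4)%N. by lia.
    by have := xK (Ordinal m4); rewrite /= addnA subnKC.
  have K0 := Kl 0%N isT; have K1 := Kl 1%N isT; have K2 := Kl 2%N isT.
  rewrite !addnS !addn0 in K0 K1 K2.
  apply/and4P; split.
  - by rewrite (leq_trans _ nl)// (leq_trans n01).
  - have [ub <-] := bigP (L (lev x) (size (B (lev x)))).
    apply: (size_inside (x := x)) => //; apply/insideP => k kb.
    rewrite inE; apply/andP; split; [apply: (insideP _ _ _ K1)|apply: (insideP _ _ _ K2)].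
      exact: Kbig.
    by apply: Kmono (leqnSn _) _ _; exact: Kbig.
  - apply/fsubsetP => y; rewrite inE => /andP[y1 _].
    rewrite -(mulgVK x y); apply: (insideP _ _ _ xB).
    have yB := tauBd _ _ _ y1; rewrite mem_cat.
    have /predU1P[E1|] : (lev x == n.+1) || (lev x < n.+1)%N by rewrite -leq_eqVlt.
      by rewrite E1 in yB; rewrite yB orbT.
    rewrite ltnS => ln'; have E1 : lev x = n by apply/eqP; rewrite eqn_leq nl ln'.
    by rewrite E1 in yB; rewrite yB.
  - apply/insideP => k kW; have kK l : (n0 <= l)%N -> k \in K l.
      by move=> n0l; apply: KW; exact: Wmono' n0l _ kW.
    have n0l : (n0 <= lev x)%N by rewrite (leq_trans _ nl)// (leq_trans n01).
    rewrite !inE; apply/and3P; split.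
    + by apply: (insideP _ _ _ K0); exact: kK.
    + by apply: (insideP _ _ _ K1); apply: kK; exact: leqW.
    + by apply: (insideP _ _ _ K2); apply: kK; exact/leqW/leqW.
rewrite !big_split/= exchange_big/=.
have sE : \sum_(x <- F N) (x \in E n)%:R <= ep n * #|` F N|%:R.
  apply: le_trans gE; rewrite sum_indic ler_nat fsubset_leq_card//.
  by apply/fsubsetP => x; rewrite !inE => /andP[].
have sT : \sum_(m < 4) \sum_(x <- F N)
    (~~ inside (K (n + m)%N) (tau (n + m)%N x) x)%:R <= 4 * (ep n * #|` F N|%:R).
  rewrite mulr_natl -[in leRHS](card_ord 4) -sumr_const.
  by apply: ler_sum => m _; exact: gtau.
apply: (@le_trans _ _ (6 * ep n * #|` F N|%:R)); first lra.
by rewrite ler_wpM2r// (le_trans _ epn1)// ler_wpM2l// ep_le.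
Unshelve. all: end_near. Qed.

End MultiscalePartition.

(** * Sequences with prescribed pattern frequencies *)

Section GenericSequence.
Context {d : measure_display} (R : realType) (G : groupType).
Variables (F : nat -> {fset G}).
Hypothesis F_folner : left_folner R F.
Hypothesis G_countable : countable [set: G].
Hypothesis G_infinite : infinite_set [set: G].
Variables (X : measurableType d) (P : probability X R) (T : G -> X -> X).
Hypothesis T_mpa : measure_preserving_action P T.

(** With [C] the factor in the bound, one discrepancy is at most the square root of [C * #|S|],
    which is below [#|S| / l.+1] once [#|S|] reaches [C * l.+1 ^ 2]. *)
Lemma discrepancy_cell (A : nat -> set X) (y : G -> X) (S : {fset G}) (l b : nat) i :
  (i < l)%N -> (0 < #|` S|)%N ->
  \sum_(j < l) discrepancy P T (A j) y S ^+ 2 <=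
    (l%:R * b%:R ^+ 2 + 1) * #|` S|%:R ->
  (l%:R * b%:R ^+ 2 + 1) * l.+1%:R ^+ 2 <= #|` S|%:R :> R ->
  `|discrepancy P T (A i) y S| <= l.+1%:R^-1 * #|` S|%:R.
Proof.
move=> il S0; set C := _ + 1; set s := #|` S|%:R; move=> sumle Cs.
have s0 : 0 < s by rewrite ltr0n.
have l0 : 0 < l.+1%:R :> R by [].
rewrite -(@ler_pXn2r _ 2)// ?nnegrE// ?mulr_ge0 ?invr_ge0// real_normK ?num_real//.
apply: (@le_trans _ _ (C * s)).
  apply: le_trans sumle; rewrite (bigD1 (Ordinal il))//= lerDl.
  by apply: sumr_ge0 => j _; exact: sqr_ge0.
rewrite exprMn [s ^+ 2]expr2 mulrA ler_pM2r// mulrC exprVn.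
by rewrite ler_pdivlMr// exprn_gt0.
Qed.

(** A coarse cell of level [l] balances only the first [l] events; each fixed event is eventually
    handled because low levels have density zero along [F]. *)
Theorem generic_sequence (Y : Type) (f : X -> Y)
    (Ev : nat -> (G -> Y) -> Prop) (win : nat -> seq G) :
  (forall i u v, (forall h, h \in win i -> u h = v h) -> Ev i u -> Ev i v) ->
  (forall i, measurable [set x | Ev i (fun h => f (T h x))]) ->
  exists z : G -> Y, (forall g, exists x, z g = f x) /\ forall i,
    (#|` F N|%:R^-1 *
      \sum_(g <- F N) (`[< Ev i (fun h => z (h * g)%g) >])%:R : R) @[N --> \oo]
    --> fine (P [set x | Ev i (fun h => f (T h x))]).
Proof.
move=> Ev_loc; set Om := fun i => [set x | Ev i (fun h => f (T h x))] => mOm.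
pose W n := flatten [seq win i | i <- iota 0 n.+1].
have winW i n : (i <= n)%N -> {subset win i <= W n}.
  move=> ni h hi; apply/flattenP; exists (win i) => //.
  by apply: map_f; rewrite mem_iota.
have Wmono n : {subset W n <= W n.+1}.
  move=> h /flattenP[_ /mapP[i + ->] hi]; rewrite mem_iota => /andP[_].
  by rewrite add0n ltnS => ni; apply: (winW i) => //; exact: leqW.
(* The threshold demanded by [discrepancy_cell]. *)
pose L n b := Num.bound ((n%:R * b%:R ^+ 2 + 1) * n.+1%:R ^+ 2 : R).
have [lev [gam [Gam [b [gamP GamP gamG levG [gamb dens]]]]]] :=
  multiscale_partition F_folner G_countable G_infinite L Wmono.
have levg x w : w \in gam x -> lev w = lev x by move=> /(fsubsetP (gamG x))/levG.
have Gamg x w : w \in gam x -> Gam w = Gam x.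
  by move=> /(fsubsetP (gamG x)); exact: GamP.2.
have [sel selP] : {sel : nat * {fset G} -> {fset G} -> X & forall p,
    (forall x, x \in p.2 -> (#|` gam x| <= b p.1)%N /\ (gam x `<=` p.2)%fset) ->
    \sum_(j < p.1) discrepancy P T (Om j) (sel p \o gam) p.2 ^+ 2 <=
      (p.1%:R * (b p.1)%:R ^+ 2 + 1) * #|` p.2|%:R}.
  apply: (@choice _ _ (fun p y => (forall x, x \in p.2 ->
      (#|` gam x| <= b p.1)%N /\ (gam x `<=` p.2)%fset) ->
    \sum_(j < p.1) discrepancy P T (Om j) (y \o gam) p.2 ^+ 2 <=
      (p.1%:R * (b p.1)%:R ^+ 2 + 1) * #|` p.2|%:R)) => -[l S] /=.
  have [H|nH] := pselect (forall x, x \in S ->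
      (#|` gam x| <= b l)%N /\ (gam x `<=` S)%fset); last first.
    by exists (fun=> point) => /nH.
  have [y yP] := select_points T_mpa l mOm gamP
    (fun x xS => (H x xS).1) (fun x xS => (H x xS).2).
  by exists y.
(* The level and both cells are constant on [gam g], hence so is [y], and [z] follows a single orbit
   there. *)
pose y g := sel (lev g, Gam g) (gam g).
pose z g := f (T g (y g)).
have disc i x : (i < lev x)%N -> (L (lev x) (b (lev x)) <= #|` Gam x|)%N ->
    `|discrepancy P T (Om i) y (Gam x)| <= (lev x).+1%:R^-1 * #|` Gam x|%:R.
  move=> il Lx.
  have -> : discrepancy P T (Om i) y (Gam x) =
      discrepancy P T (Om i) (sel (lev x, Gam x) \o gam) (Gam x).
    rewrite /discrepancy big_seq [RHS]big_seq; apply: eq_bigr => g gx.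
    by rewrite /y (levG _ _ gx) (GamP.2 _ _ gx).
  apply: (@discrepancy_cell _ _ _ _ (b (lev x))) => //.
  - exact: partition_card_gt0.
  - apply: (selP (lev x, Gam x)) => w wx /=; rewrite -(levG _ _ wx); split => //.
    by rewrite -(GamP.2 _ _ wx).
  - apply: le_trans (_ : (L (lev x) (b (lev x)))%:R <= _); last by rewrite ler_nat.
    by apply/ltW/archi_boundP; rewrite mulr_ge0// ?addr_ge0// ?mulr_ge0// exprn_ge0.
exists z; split=> [g|i]; first by exists (T g (y g)).
have /andP[] := fine_probability_le1 P (mOm i).
rewrite -/(Om i); set p := fine _ => p0 p1.
apply/cvgrPdist_le => eps eps0.
(* Final budget: [2 * (eps / 6)] for replacing [h] by [u], [eps / 2] for cells inside [F N],
   [eps / 6] for cells leaving it. *)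
have eps6 : 0 < eps / 6 by rewrite divr_gt0.
have [n ni epn] : exists2 n, (i < n)%N & n.+1%:R^-1 <= eps / 2.
  exists (maxn i.+1 (Num.bound (2 / eps))); first by rewrite leq_maxl.
  rewrite -[leRHS]invrK lef_pV2 ?posrE ?invr_gt0 ?divr_gt0// invf_div.
  apply/ltW/(lt_le_trans (archi_boundP _)); first by rewrite divr_ge0// ltW.
  by rewrite ler_nat (leq_trans (leq_maxr i.+1 _)).
have near_dens := dens n _ eps6.
near=> N.
have FN0 := folner_card_gt0 F_folner N.
pose ok x := [&& (n <= lev x)%N, (L (lev x) (b (lev x)) <= #|` Gam x|)%N,
  (Gam x `<=` F N)%fset & inside (W n) (gam x) x].
have Nok : \sum_(x <- F N) (~~ ok x)%:R <= eps / 6 * #|` F N|%:R.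
  by rewrite /ok; near: N; exact: near_dens.
pose big x := (n <= lev x)%N && (L (lev x) (b (lev x)) <= #|` Gam x|)%N.
pose h g : R := (`[< Ev i (fun h => z (h * g)%g) >])%:R - p.
(* Patterns of [z] are replaced by patterns of orbits, and cells of low level or small size are set
   to zero as a whole, so that every coarse cell has a small sum. *)
pose u g : R := if big g then (`[< Om i (T g (y g)) >])%:R - p else 0.
have u1 g : `|u g| <= 1.
  rewrite /u; case: ifP => _; rewrite ?normr0//.
  by rewrite ler_norml; case: `[< _ >] => /=; apply/andP; split; lra.
have h1 g : `|h g| <= 1.
  by rewrite /h ler_norml; case: `[< _ >] => /=; apply/andP; split; lra.
have hu g : `|h g - u g| <= 2 * (~~ ok g)%:R.
  have [/and4P[nl Ll GF /insideP gW]|_] := boolP (ok g); last first.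
    by rewrite mulr1 (le_trans (ler_normB _ _))// -[2]/(1 + 1) lerD.
  rewrite mulr0 normr_le0 subr_eq0 /h /u /big nl Ll/=.
  have zE k : k \in win i -> z (k * g)%g = f (T k (T g (y g))).
    move=> ki; have kg : (k * g)%g \in gam g by apply/gW/(winW i n (ltnW ni)).
    by rewrite /z (mpa_comp T_mpa) /y (levg _ _ kg) (Gamg _ _ kg) (gamP.2 _ _ kg).
  apply/eqP; congr ((nat_of_bool _)%:R - _); apply: asbool_equiv_eq; split.
    by apply: Ev_loc => k /zE ->.
  by apply: Ev_loc => k /zE ->.
have bigG x g : g \in Gam x -> big g = big x.
  by move=> gx; rewrite /big (levG _ _ gx) (GamP.2 _ _ gx).
have ucell x : `|\sum_(g <- Gam x) u g| <= n.+1%:R^-1 * #|` Gam x|%:R.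
  have [bx|bx] := boolP (big x); last first.
    rewrite big_seq big1 ?normr0 ?mulr_ge0 ?invr_ge0// => g gx.
    by rewrite /u (bigG _ _ gx) (negbTE bx).
  have [nl Ll] := andP bx.
  have -> : \sum_(g <- Gam x) u g = discrepancy P T (Om i) y (Gam x).
    rewrite big_seq /discrepancy [RHS]big_seq; apply: eq_bigr => g gx.
    by rewrite /u (bigG _ _ gx) bx.
  apply: le_trans (disc _ _ (leq_trans ni nl) Ll) _.
  by rewrite ler_wpM2r// lef_pV2 ?posrE// ler_nat.
have GFok : \sum_(g <- F N) (~~ (Gam g `<=` F N)%fset)%:R <= eps / 6 * #|` F N|%:R.
  apply: le_trans Nok; apply: ler_sum => g _; rewrite ler_nat /ok.
  by case: (_ `<=` _)%fset; rewrite //= !andbF.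
have n0 : 0 <= n.+1%:R^-1 :> R by rewrite invr_ge0.
have usum : `|\sum_(g <- F N) u g| <=
    n.+1%:R^-1 * #|` F N|%:R + 1 * \sum_(g <- F N) (~~ (Gam g `<=` F N)%fset)%:R.
  rewrite ler_norml -lerNl -sumrN; apply/andP; split; apply: sum_cells => //.
  - by move=> g; apply: le_trans (u1 g); rewrite -normrN ler_norm.
  - move=> x _ _; apply: le_trans (ucell x).
    by rewrite sumrN -normrN ler_norm.
  - by move=> g; apply: le_trans (u1 g); rewrite ler_norm.
  - by move=> x _ _; apply: le_trans (ucell x); rewrite ler_norm.
have husum : `|\sum_(g <- F N) (h g - u g)| <= 2 * (eps / 6 * #|` F N|%:R).
  apply: le_trans (ler_norm_sum _ _ _) _.
  apply: le_trans (ler_sum _ (fun g _ => hu g)) _.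
  by rewrite -mulr_sumr ler_pM2l.
have hE : p - #|` F N|%:R^-1 * \sum_(g <- F N) (`[< Ev i (fun h => z (h * g)%g) >])%:R =
    - (#|` F N|%:R^-1 * \sum_(g <- F N) h g).
  rewrite /h sumrB mulrBr opprB; congr (_ - _).
  under eq_bigr do rewrite -[p]mulr1.
  by rewrite -mulr_sumr sumr1 mulrCA mulVf ?mulr1 ?gt_eqF.
rewrite hE normrN normrM normfV normr_nat mulrC ler_pdivrMr//.
have -> : \sum_(g <- F N) h g = \sum_(g <- F N) (h g - u g) + \sum_(g <- F N) u g.
  by rewrite -big_split/=; apply: eq_bigr => g _; rewrite subrK.
apply: le_trans (ler_normD _ _) _.
apply: le_trans (lerD husum usum) _.
move: GFok epn; set a := n.+1%:R^-1; set c := \sum_(g <- _) _.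
move: a c (#|` F N|%:R) FN0 => a c s s0 cs; rewrite -(ler_pM2r s0); lra.
Unshelve. all: end_near. Qed.

End GenericSequence.

(** * Ultraproduct of the Folner sets and its Loeb measure *)

Section Ultralimits.
Variables (U : set_system nat) (UU : UltraFilter U).

Lemma ultra_meet (A B : set nat) : U A -> U B -> exists N, A N /\ B N.
Proof. by move=> UA UB; have [N] := filter_ex (filterI UA UB); exists N. Qed.

Lemma ultra_compact_cvg (V : topologicalType) (K : set V) (u : nat -> V) :
  compact K -> (forall n, K (u n)) -> exists2 l, K l & u @ U --> l.
Proof.
move=> cK Ku; have [|l [Kl ul]] := cK (u @ U) _ _.
  by apply: (filterS (F := U) _ filterT) => n _; exact: Ku.
exists l => // B Bl; have [//|UB] := in_ultra_setVsetC (u @^-1` B) UU.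
have [y [By nBy]] : (~` B `&` B) !=set0 by exact: ul.
by [].
Qed.

Lemma ultra_bounded_cvg (R : realType) (u : nat -> R) a b :
  (forall n, a <= u n <= b) -> u @ U --> lim (u @ U).
Proof.
move=> uab; have [||l _ ul] := @ultra_compact_cvg R `[a, b]%classic u.
- exact: segment_compact.
- by move=> n /=; rewrite in_itv/=; exact: uab.
by apply/cvg_ex; exists l.
Qed.

End Ultralimits.

(* The countable internal product of copies of [G] over the ultrafilter [U],
   before identification of sequences that agree on a set of [U]. *)
Definition loeb_points (G : groupType) (U : set_system nat)
  (UU : UltraFilter U) : Type := nat -> G.

(** * The algebra of internal sets and countable saturation *)

Section InternalSets.
Variables (G : groupType) (U : set_system nat) (UU : UltraFilter U).
Local Notation X := (loeb_points G UU).
Implicit Types A B : nat -> set G.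

HB.instance Definition _ := gen_eqMixin X.
HB.instance Definition _ := gen_choiceMixin X.
HB.instance Definition _ := isPointed.Build X (fun=> 1%g).

Definition internal A : set X := [set x | U [set N | A N (x N)]].

Definition internal_sets : set (set X) := range internal.

Lemma internalU A B :
  internal A `|` internal B = internal (fun N => A N `|` B N).
Proof.
apply/seteqP; split=> [x [xA|xB]|x xAB].
- by apply: filterS xA => N; left.
- by apply: filterS xB => N; right.
- have [xA|nxA] := in_ultra_setVsetC [set N | A N (x N)] UU; first by left.
  by right; apply: filterS (filterI xAB nxA) => N [[]].
Qed.

Lemma internalC A : ~` internal A = internal (fun N => ~` A N).
Proof.
apply/seteqP; split=> [x nxA|x xA xA'].
  by have [|//] := in_ultra_setVsetC [set N | A N (x N)] UU.
have [N []] := ultra_meet UU xA xA'; exact.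
Qed.

Lemma internal0 : internal (fun=> set0) = set0.
Proof.
by apply/seteqP; split=> // x /= /filter_ex[].
Qed.

Lemma internal_sets0 : internal_sets set0.
Proof. by exists (fun=> set0); rewrite ?internal0. Qed.

Lemma internal_setsU : setU_closed internal_sets.
Proof. by move=> _ _ [A _ <-] [B _ <-]; rewrite internalU; eexists. Qed.

Lemma internal_setsC : setC_closed internal_sets.
Proof. by move=> _ [A _ <-]; rewrite internalC; eexists. Qed.

HB.instance Definition _ :=
  isAlgebraOfSets.Build default_measure_display X
    internal_sets0 internal_setsU internal_setsC.

Lemma internal_nonempty A : U [set N | A N !=set0] -> internal A !=set0.
Proof.
move=> UA; exists (fun N => xget 1%g (A N)); apply: filterS UA => N [g Ag].
by apply: xgetPex; exists g.
Qed.

(** Otherwise points picked in the differences form a counterexample. Hence an internal set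
    determines its representing sequence up to [U]-almost everywhere equality. *)
Lemma internal_sub A B : internal A `<=` internal B ->
  U [set N | A N `<=` B N].
Proof.
move=> AB; have [//|nAB] := in_ultra_setVsetC [set N | A N `<=` B N] UU.
have [x xAB] : internal (fun N => A N `\` B N) !=set0.
  apply: internal_nonempty; apply: filterS nAB => N /=.
  by move=> /existsNP[g /not_implyP[Ag nBg]]; exists g.
have /AB xB : internal A x by apply: filterS xAB => N [].
by have [N [[_ nB]]] := ultra_meet UU xAB xB.
Qed.

(* Countable saturation: a point missing all [B k] is obtained by diagonalizing
   points that miss more and more of them. *)
Lemma internal_saturation (U_oo : \oo `<=` U) A (B : nat -> nat -> set G) :
  internal A `<=` \bigcup_k internal (B k) ->
  exists n, internal A `<=` \bigcup_(k < n) internal (B k).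
Proof.
move=> AB; apply: contrapT => /forallNP H.
pose C n N := A N `\` \bigcup_(k < n) B k N.
have UC n : U [set N | C n N !=set0].
  have [//|nC] := in_ultra_setVsetC [set N | C n N !=set0] UU.
  exfalso; apply: (H n) => x xA.
  have /= UB : U [set N | (\bigcup_(k < n) B k N) (x N)].
    apply: filterS (filterI nC xA) => N [] /= nCN AN.
    by apply: contrapT => nB; apply: nCN; exists (x N).
  elim: n UB {nC H} => [|n IH] UB.
    by have /filter_ex[N []] := UB.
  have [xB|nxB] := in_ultra_setVsetC [set N | B n N (x N)] UU.
    by exists n => //=.
  have [|k kn xk] := IH; last by exists k => //=; exact: ltnW.
  apply: filterS (filterI UB nxB) => N [[k /=]].
  rewrite ltnS leq_eqVlt => /predU1P[->//|kn xk _]; by exists k.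
(* [best N N] is the last index up to [N] whose set [C] at [N] is nonempty. It exceeds every [n]
   almost everywhere, because [U] contains the tails. *)
pose fix best N k := if `[< C k N !=set0 >] then k
  else if k is k'.+1 then best N k' else 0%N.
have bestP N n k : (n <= k)%N -> C n N !=set0 ->
    (n <= best N k)%N /\ C (best N k) N !=set0.
  elim: k => [|k IH]; first by rewrite leqn0 => /eqP -> C0 /=; rewrite asboolT.
  rewrite leq_eqVlt => /predU1P[-> Ck|nk Cn] /=; first by rewrite asboolT.
  by case: asboolP => Ck; [split=> //; exact: ltnW|exact: IH].
pose x N := xget 1%g (C (best N N) N).
have UCx n : U [set N | (n <= best N N)%N /\ C (best N N) N (x N)].
  have Un : U [set N | (n <= N)%N] by apply: U_oo; exact: nbhs_infty_ge.
  apply: filterS (filterI Un (UC n)) => N [nN CN].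
  by have [nb Cb] := bestP _ _ _ nN CN; split=> //; apply: xgetPex.
have [|k _ xk] := AB x.
  by apply: filterS (UCx 0%N) => N [_ []].
have [N [[kb [_ nB]] Bk]] := ultra_meet UU (UCx k.+1) xk.
by apply: nB; exists k.
Qed.

End InternalSets.

Section UltralimitLemmas.
Variables (R : realType) (U : set_system nat) (UU : UltraFilter U).
Implicit Types (u v : nat -> R).

Lemma ultra_limE u (l : R) : u @ U --> l -> lim (u @ U) = l.
Proof. by move=> ul; apply: cvg_lim => //; exact: Rhausdorff. Qed.

Lemma ultra_lim_dist u v (l l' e : R) : u @ U --> l -> v @ U --> l' ->
  U [set N | `|u N - v N| <= e] -> `|l - l'| <= e.
Proof.
move=> ul vl uve; rewrite leNgt; apply/negP => ell.
have d0 : 0 < (`|l - l'| - e) / 2 by rewrite divr_gt0// subr_gt0.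
have /cvgrPdist_lt/(_ _ d0) Ul := ul; have /cvgrPdist_lt/(_ _ d0) Vl := vl.
have [N [/= [uN vN] eN]] := ultra_meet UU (filterI Ul Vl) uve.
have : l - l' = (l - u N) + (u N - v N) - (l' - v N) by ring.
move=> E; have : `|l - l'| <= `|l - u N| + `|u N - v N| + `|l' - v N|.
  by rewrite {1}E (le_trans (ler_normB _ _))// lerD2r ler_normD.
by move: uN vN eN => /=; lra.
Qed.

Lemma ultra_finite (I : finType) (c : nat -> I) : exists i, U [set N | c N = i].
Proof.
apply: contrapT => /forallNP nU.
have nUc i : U [set N | c N <> i].
  by have [/nU|//] := in_ultra_setVsetC [set N | c N = i] UU.
have : U [set N | forall i, c N <> i] by apply: filter_forall.
by move=> /filter_ex[N /(_ (c N))].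
Qed.

End UltralimitLemmas.

(** * From limiting frequencies to the Loeb measure *)

Section LoebMeasure.
Variables (R : realType) (G : groupType) (F : nat -> {fset G}).
Hypothesis F_neq0 : forall N, F N != fset0.
Variables (U : set_system nat) (UU : UltraFilter U).
Hypothesis U_oo : \oo `<=` U.
Local Notation X := (loeb_points G UU).
Implicit Types (A B : nat -> set G) (w : nat -> G -> R).

Definition average w N : R := #|` F N|%:R^-1 * \sum_(g <- F N) w N g.

Definition freq A := average (fun N g => (`[< A N g >])%:R).

Lemma average_le w v N : (forall g, w N g <= v N g) ->
  average w N <= average v N.
Proof. by move=> wv; rewrite ler_wpM2l// ?invr_ge0//; exact: ler_sum. Qed.

Lemma average_cst (c : R) N : average (fun _ _ => c) N = c.
Proof.
rewrite /average -[c in LHS]mulr1 -mulr_sumr sumr1 mulrCA mulVf ?mulr1//.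
by rewrite pnatr_eq0 cardfs_eq0.
Qed.

Lemma averageB w v N :
  average (fun N g => w N g - v N g) N = average w N - average v N.
Proof. by rewrite /average sumrB mulrBr. Qed.

Lemma averageD w v N :
  average (fun N g => w N g + v N g) N = average w N + average v N.
Proof. by rewrite /average big_split/= mulrDr. Qed.

Lemma average_dist w v N e : (forall g, `|w N g - v N g| <= e) ->
  `|average w N - average v N| <= e.
Proof.
move=> wv; rewrite -averageB ler_norml; apply/andP; split.
  rewrite -[leLHS](average_cst _ N); apply: average_le => g.
  by have := wv g; rewrite ler_norml => /andP[].
rewrite -[leRHS](average_cst _ N); apply: average_le => g.
by have := wv g; rewrite ler_norml => /andP[].
Qed.

Lemma average_cvg w M : (forall N g, `|w N g| <= M) ->
  average w @ U --> lim (average w @ U).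
Proof.
move=> wM; apply: (@ultra_bounded_cvg U UU R _ (- M) M) => N.
rewrite -ler_norml -[average w N]subr0 -[0](average_cst _ N).
by apply: average_dist => g; rewrite subr0.
Qed.

Lemma freq_cvg A : freq A @ U --> lim (freq A @ U).
Proof.
by apply: (@average_cvg _ 1) => N g; rewrite normr_nat lern1 leq_b1.
Qed.

Lemma freq_ge0 A : 0 <= lim (freq A @ U).
Proof.
apply: limr_ge; first by apply/cvg_ex; eexists; exact: freq_cvg.
by near=> N; rewrite mulr_ge0 ?invr_ge0// sumr_ge0.
Unshelve. all: end_near. Qed.

Lemma lim_freq_eq A B : U [set N | A N = B N] ->
  lim (freq A @ U) = lim (freq B @ U).
Proof.
move=> AB; apply: ultra_limE; apply: (@cvg_trans _ (freq B @ U)); last exact: freq_cvg.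
apply: near_eq_cvg; apply: filterS AB => N /= ABN.
by rewrite /freq /average ABN.
Qed.

(** A representing sequence is chosen, with a junk value off the internal sets; [loeb_contentE]
    shows that the choice is immaterial. *)
Definition loeb_content (S : set X) : \bar R :=
  (lim (freq (xget (fun=> set0) [set A | internal A = S]) @ U))%:E.

Lemma loeb_contentE A : loeb_content (@internal G U UU A) = (lim (freq A @ U))%:E.
Proof.
congr EFin; apply: lim_freq_eq; set B := xget _ _.
have BA : @internal G U UU B = @internal G U UU A.
  exact: (@xgetPex _ (fun=> set0)
    [set A' | @internal G U UU A' = @internal G U UU A] (ex_intro _ A erefl)).
have /internal_sub AB : @internal G U UU A `<=` @internal G U UU B by rewrite BA.
have /internal_sub BA' : @internal G U UU B `<=` @internal G U UU A by rewrite BA.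
by apply: filterS (filterI AB BA') => N [? ?]; apply/seteqP.
Qed.

Lemma loeb_content0 : loeb_content set0 = 0%E.
Proof.
rewrite -(internal0 G UU) loeb_contentE; congr EFin; apply: ultra_limE.
rewrite (_ : freq _ = fun=> 0); first exact: cvg_cst.
apply/funext => N; rewrite -[RHS](average_cst 0 N); congr average.
by apply/funext => n; apply/funext => g; rewrite asboolF.
Qed.

Lemma loeb_contentT : loeb_content setT = 1%E.
Proof.
rewrite -setC0 -(internal0 G UU) internalC loeb_contentE; congr EFin.
apply: ultra_limE; rewrite (_ : freq _ = fun=> 1); first exact: cvg_cst.
apply/funext => N; rewrite -[RHS](average_cst 1 N); congr average.
by apply/funext => n; apply/funext => g; rewrite asboolT.
Qed.

Lemma loeb_content_ge0 S : (0 <= loeb_content S)%E.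
Proof. by rewrite lee_fin; exact: freq_ge0. Qed.

Lemma loeb_contentU (S S' : set X) : measurable S -> measurable S' ->
  S `&` S' = set0 ->
  loeb_content (S `|` S') = (loeb_content S + loeb_content S')%E.
Proof.
move=> [A _ <-] [B _ <-] AB0; rewrite internalU !loeb_contentE -EFinD; congr EFin.
apply: ultra_limE.
apply: (@cvg_trans _ ((fun N => freq A N + freq B N) @ U)); last first.
  by apply: cvgD; exact: freq_cvg.
have ABd : U [set N | A N `<=` ~` B N].
  apply: (@internal_sub G U UU); rewrite -internalC => x xA xB.
  by have : set0 x by rewrite -AB0.
apply: near_eq_cvg; apply: filterS ABd => N /= ABN.
rewrite /freq -averageD /average; congr (_ * _); apply: eq_bigr => g _.
have [Ag|nAg] := pselect (A N g).
  by rewrite (asboolT Ag) (asboolF (ABN _ Ag)) addr0 asboolT//; left.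
rewrite (asboolF nAg) add0r; congr ((nat_of_bool _)%:R).
by apply: asbool_equiv_eq; split=> [|[]//]; right.
Qed.

(** By saturation an internal countable union is already the union of finitely many terms, so the
    partial sums are eventually constant. *)
Lemma loeb_content_sigma_additive : semi_sigma_additive loeb_content.
Proof.
move=> S mS tS mUS.
have Sfin n : measurable (\big[setU/set0]_(i < n) S i) /\
    (\sum_(0 <= i < n) loeb_content (S i))%E =
      loeb_content (\big[setU/set0]_(i < n) S i).
  elim: n => [|n [IHm IH]].
    by rewrite big_ord0 big_nil loeb_content0; split=> //; exact: measurable0.
  rewrite big_ord_recr/=; split; first exact: measurableU.
  rewrite big_nat_recr//= IH loeb_contentU//.
  rewrite -bigcup_mkord setI_bigcupl; apply: bigcup0 => i /= ni.
  by move/trivIsetP : tS; apply => //; rewrite lt_eqF.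
have [A_ A_P] : {A_ : nat -> nat -> set G & forall k, internal (A_ k) = S k}.
  by apply: (@choice _ _ (fun k A => internal A = S k)) => k; have [A _ <-] := mS k; exists A.
have [A _ AS] := mUS.
have [|n Sn] := @internal_saturation G U UU U_oo A A_.
  by rewrite AS => x [k _ xk]; exists k => //; rewrite A_P.
have USn m : (n <= m)%N -> \bigcup_k S k = \big[setU/set0]_(i < m) S i.
  move=> nm; rewrite -bigcup_mkord; apply/seteqP; split=> [x|x [k _ xk]]; last by exists k.
  rewrite -AS => /Sn[k /= kn xk]; exists k; first exact: leq_trans nm.
  by rewrite -A_P.
apply: cvg_near_cst; near=> m.
by rewrite (Sfin m).2 (USn m)//; near: m; exact: nbhs_infty_ge.
Unshelve. all: end_near. Qed.

HB.instance Definition _ := isMeasure.Build _ X R loeb_content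
  loeb_content0 loeb_content_ge0 loeb_content_sigma_additive.

Definition loeb_type : Type := g_sigma_algebraType (@measurable _ X).

HB.instance Definition _ := Measurable.on loeb_type.

Definition loeb_measure : set loeb_type -> \bar R :=
  measure_extension loeb_content.

HB.instance Definition _ := Measure.on loeb_measure.

Lemma loeb_measureE A :
  loeb_measure (@internal G U UU A) = (lim (freq A @ U))%:E.
Proof.
by rewrite -loeb_contentE; apply: measurable_mu_extE; exists A.
Qed.

Lemma loeb_measureT : loeb_measure setT = 1%E.
Proof.
rewrite -loeb_contentT; apply: measurable_mu_extE; exact: measurableT.
Qed.

HB.instance Definition _ :=
  Measure_isProbability.Build _ _ _ loeb_measure loeb_measureT.

Lemma measurable_internal A : measurable (@internal G U UU A : set loeb_type).
Proof. by apply: sub_sigma_algebra; exists A. Qed.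

End LoebMeasure.

Section LoebIntegral.
Variables (R : realType) (G : groupType) (F : nat -> {fset G}).
Hypothesis F_neq0 : forall N, F N != fset0.
Variables (U : set_system nat) (UU : UltraFilter U).
Hypothesis U_oo : \oo `<=` U.
Local Notation X := (loeb_type G UU).
Local Notation mu := (@loeb_measure R G F F_neq0 U UU U_oo).

Lemma finite_coding (w : G -> R) (M e : R) : (forall g, `|w g| <= M) -> 0 < e ->
  exists n (a : 'I_n -> R) (c : G -> 'I_n), forall g, `|w g - a (c g)| <= e.
Proof.
move=> wM e0; pose t g := Num.truncn ((w g + M) / e).
have wM0 g : 0 <= (w g + M) / e.
  by rewrite divr_ge0 ?(ltW e0)//; have := wM g; rewrite ler_norml; lra.
have tn g : (t g < (Num.truncn (2 * M / e)).+1)%N.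
  rewrite ltnS le_truncn// ler_pM2r ?invr_gt0//.
  by have := wM g; rewrite ler_norml; lra.
exists (Num.truncn (2 * M / e)).+1, (fun i => i%:R * e - M), (fun g => Ordinal (tn g)) => g /=.
have /andP[] := truncn_itv (wM0 g); rewrite -/(t g) ler_pdivlMr// ltr_pdivrMr// -natr1.
by rewrite ler_norml; lra.
Qed.

(** Up to [e], [w] takes finitely many values. Its level sets define internal sets, on which measure
    and limiting frequency agree, and a point [x] has one colour for almost all [N]. Both sides are
    thus within [e] of the same finite sum. *)
Lemma loeb_mean (w : G -> R) (M : R) (u : X -> R) : (forall g, `|w g| <= M) ->
  (forall x : X, (fun N => w (x N)) @ U --> u x) ->
  has_mean mu u (lim (average F (fun _ => w) @ U)).
Proof.
move=> wM uw.
have approx e : 0 < e -> exists v m, [/\ has_mean mu v m,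
    forall x, `|u x - v x| <= e & `|lim (average F (fun _ => w) @ U) - m| <= e].
  move=> e0; have [n [a [c wac]]] := finite_coding wM e0.
  pose A i := fun _ : nat => [set g | c g = i].
  exists (fun x => \sum_(i < n) a i * (`[< @internal G U UU (A i) x >])%:R).
  exists (\sum_(i < n) a i * lim (freq R F (A i) @ U)); split.
  - apply: has_mean_sum => i; apply: has_meanZ.
    have := has_mean_indic mu (@measurable_internal G U UU (A i)).
    have /(congr1 fine) /= := @loeb_measureE R G F F_neq0 U UU U_oo (A i).
    by move=> ->.
  - move=> x; have [i ci] := ultra_finite UU (c \o x).
    rewrite (bigD1 i)//= asboolT// mulr1 big1 ?addr0 => [|j ji].
      apply: (ultra_lim_dist UU (uw x) (cvg_cst (a i))).
      by apply: filterS ci => N /= <-.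
    rewrite asboolF ?mulr0// => cj.
    have [N [/= cNi cNj]] := ultra_meet UU ci cj.
    by rewrite -cNi -cNj eqxx in ji.
  - apply: (ultra_lim_dist (v := average F (fun _ g => a (c g))) UU).
    + exact: (average_cvg F_neq0 UU (M := M)).
    + rewrite (_ : average _ _ = fun N => \sum_(i < n) a i * freq R F (A i) N).
        apply: cvg_big => [|i _]; first exact: add_continuous.
        by apply: cvgM; [exact: cvg_cst|exact: freq_cvg].
      apply/funext => N; rewrite /freq /average.
      under [RHS]eq_bigr do rewrite mulrCA mulr_sumr.
      rewrite -mulr_sumr exchange_big/=; congr (_ * _); apply: eq_bigr => g _.
      rewrite (bigD1 (c g))//= asboolT// mulr1 big1 ?addr0// => i ic.
      by rewrite asboolF ?mulr0// => E; rewrite E eqxx in ic.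
    + by apply: filterS filterT => N _; exact: average_dist.
have um : has_mean mu u (\int[mu]_x u x).
  by apply: has_mean_approx => e /approx[v [m [vm uv _]]]; exists v, m.
suff <- : \int[mu]_x u x = lim (average F (fun _ => w) @ U) by [].
apply/eqP; rewrite -subr_eq0 -normr_le0; apply/ler_addgt0Pr => e e0; rewrite add0r.
have [|v [m [vm uv lm]]] := approx (e / 2); first by rewrite divr_gt0.
have := has_mean_dist um vm uv.
move: lm; set l := lim _; set I := \int[mu]_x _ => lm Im.
rewrite -(subrKA m) (le_trans (ler_normD _ _))// [leRHS]splitr lerD//.
by rewrite distrC.
Qed.

End LoebIntegral.

(** * Invariance of the Loeb measure *)

Section LoebAction.
Variables (R : realType) (G : groupType) (F : nat -> {fset G}).
Hypothesis F_folner : left_folner R F.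
Variables (U : set_system nat) (UU : UltraFilter U).
Hypothesis U_oo : \oo `<=` U.
Local Notation X := (loeb_type G UU).
Local Notation mu := (@loeb_measure R G F F_folner.1 U UU U_oo).

Definition loeb_act (h : G) (x : X) : X := fun N => (h * x N)%g.

Lemma loeb_act_internal h A :
  loeb_act h @^-1` (@internal G U UU A) =
  @internal G U UU (fun N => [set g | A N (h * g)%g]).
Proof. by []. Qed.

(** Shifting by [h], and shifting back by its inverse, give the two inequalities up to the boundary
    of [F N]. *)
Lemma freq_shift h A :
  lim (freq R F (fun N => [set g | A N (h * g)%g]) @ U) = lim (freq R F A @ U).
Proof.
apply/eqP; rewrite -subr_eq0 -normr_le0; apply/ler_addgt0Pr => e e0; rewrite add0r.
apply: (ultra_lim_dist UU (@freq_cvg R G F F_folner.1 U UU _)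
  (@freq_cvg R G F F_folner.1 U UU _)).
apply: U_oo; apply: filterS (folner_inside F_folner [:: h; h^-1%g] e0) => N.
set K := [:: _; _] => NK /=.
have b01 (b : bool) : 0 <= (b%:R : R) <= 1 by rewrite ler0n lern1 leq_b1.
have hK : h \in K by rewrite mem_head.
have hVK : h^-1%g \in K by rewrite !inE eqxx orbT.
have := @sum_shift R G (F N) K h (fun g => (`[< A N g >])%:R) (fun=> b01 _) hK.
have := @sum_shift R G (F N) K h^-1%g (fun g => (`[< A N (h * g)%g >])%:R)
  (fun=> b01 _) hVK.
under eq_bigr do rewrite mulVKg.
rewrite -averageB /average normrM normfV normr_nat ler_pdivrMl ?folner_card_gt0//.
by rewrite mulrC sumrB ler_norml; move: NK => /=; lra.
Qed.

Lemma measurable_loeb_act h : measurable_fun setT (loeb_act h).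
Proof.
apply: (@measurability _ _ X X _ _ (@measurable _ (loeb_points G UU))) => //.
move=> _ [_ [A _ <-] <-]; rewrite setTI loeb_act_internal.
exact: measurable_internal.
Qed.

Lemma loeb_act_preserving h (S : set X) : measurable S ->
  mu (loeb_act h @^-1` S) = mu S.
Proof.
move=> mS.
apply: (@measure_unique _ R X (@measurable _ (loeb_points G UU)) (fun=> setT)
  _ _ _ _ (pushforward mu (loeb_act h)) mu).
- by [].
- by move=> A B; exact: measurableI.
- by move=> _; exact: (@measurableT _ (loeb_points G UU)).
- by rewrite bigcup_const//; exists 0%N.
- exact: measurable_loeb_act.
- move=> mh _ [A _ <-].
  transitivity (lim (freq R F A @ U))%:E; last first.
    by apply/esym; exact: (@loeb_measureE R G F F_folner.1 U UU U_oo A).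
  rewrite -(freq_shift h).
  exact: (@loeb_measureE R G F F_folner.1 U UU U_oo
    (fun N => [set g | A N (h * g)%g])).
- move=> mh _; apply: (@le_lt_trans _ _ 1%E); last exact: ltry.
  by apply: (@probability_le1 _ _ _ mu); exact: measurableT.
- exact: mS.
Qed.

Lemma loeb_act_mpa : measure_preserving_action mu loeb_act.
Proof.
split.
- by move=> x; apply/funext => N; rewrite /loeb_act mul1g.
- by move=> g h x; apply/funext => N; rewrite /loeb_act mulgA.
- exact: measurable_loeb_act.
- exact: loeb_act_preserving.
Qed.

End LoebAction.

(** * Complex-valued continuous functions *)

Section ComplexModulus.
Variable (R : realType).
Local Notation C := R[i].
Implicit Types (x y z : C) (e : R).

(** The norm of [R[i]] is itself complex-valued; this real copy allows comparison with real
    radii. *)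
Definition cmod x : R := complex.Re `|x|.

Lemma cmodE x : `|x| = ((cmod x)%:C)%C.
Proof. by rewrite /cmod normc_def. Qed.

Lemma lt_cmod x e : (`|x| < (e%:C)%C) = (cmod x < e).
Proof. by rewrite cmodE ltcR. Qed.

Lemma le_cmod x e : (`|x| <= (e%:C)%C) = (cmod x <= e).
Proof. by rewrite cmodE lecR. Qed.

Lemma cmod_ge0 x : 0 <= cmod x.
Proof. by rewrite /cmod normc_def sqrtr_ge0. Qed.

Lemma cmodD x y : cmod (x + y) <= cmod x + cmod y.
Proof. by rewrite -le_cmod rmorphD/= -!cmodE ler_normD. Qed.

Lemma cmodBC x y : cmod (x - y) = cmod (y - x).
Proof. by rewrite /cmod distrC. Qed.

Lemma cmod_dist x y z : `|cmod (x - z) - cmod (y - z)| <= cmod (x - y).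
Proof.
rewrite ler_norml; apply/andP; split.
  have := cmodD (y - x) (x - z); rewrite subrKA cmodBC; lra.
by have := cmodD (x - y) (y - z); rewrite subrKA; lra.
Qed.

Lemma Re_le_cmod x : `|complex.Re x| <= cmod x.
Proof. by rewrite -lecR -cmodE normc_ge_Re. Qed.

Lemma Im_le_cmod x : `|complex.Im x| <= cmod x.
Proof.
rewrite /cmod normc_def /= -sqrtr_sqr ler_sqrt ?lerDr ?sqr_ge0//.
by rewrite addr_ge0// sqr_ge0.
Qed.

Lemma cmod_le_ReIm x : cmod x <= `|complex.Re x| + `|complex.Im x|.
Proof.
rewrite /cmod normc_def/= -[leRHS]ger0_norm ?addr_ge0// -sqrtr_sqr ler_sqrt ?sqr_ge0//.
rewrite sqrrD !real_normK ?num_real// -addrA [_ *+ 2 + _]addrC addrA lerDl.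
by rewrite mulrn_wge0// mulr_ge0.
Qed.

Lemma gt0_complex (eps : C) : 0 < eps -> exists2 e, 0 < e & eps = (e%:C)%C.
Proof.
case: eps => a b; rewrite ltcE /= => /andP[/eqP -> a0].
by exists a.
Qed.

Lemma cvgC {T : Type} (F : set_system T) {FF : Filter F} (u : T -> C) l :
  u @ F --> l <-> forall e, 0 < e -> \forall t \near F, cmod (l - u t) < e.
Proof.
split=> [/cvgrPdist_lt ul e e0|ul].
  have e0' : 0 < (e%:C)%C :> C by rewrite ltcR.
  by apply: filterS (ul _ e0') => t; rewrite lt_cmod.
apply/cvgrPdist_lt => _ /gt0_complex[e e0 ->].
by apply: filterS (ul _ e0) => t; rewrite lt_cmod.
Qed.

Lemma cvg_cmod {T : Type} (F : set_system T) {FF : Filter F} (u : T -> C) l y :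
  u @ F --> l -> (fun t => cmod (u t - y)) @ F --> cmod (l - y).
Proof.
move=> /cvgC ul; apply/cvgrPdist_lt => e e0; apply: filterS (ul _ e0) => t.
exact/le_lt_trans/cmod_dist.
Qed.

Lemma cvg_Re {T : Type} (F : set_system T) {FF : Filter F} (u : T -> C) l :
  u @ F --> l -> (fun t => complex.Re (u t)) @ F --> complex.Re l.
Proof.
move=> /cvgC ul; apply/cvgrPdist_lt => e e0; apply: filterS (ul _ e0) => t.
by apply: le_lt_trans; rewrite -raddfB Re_le_cmod.
Qed.

Lemma cvg_Im {T : Type} (F : set_system T) {FF : Filter F} (u : T -> C) l :
  u @ F --> l -> (fun t => complex.Im (u t)) @ F --> complex.Im l.
Proof.
move=> /cvgC ul; apply/cvgrPdist_lt => e e0; apply: filterS (ul _ e0) => t.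
by apply: le_lt_trans; rewrite -raddfB Im_le_cmod.
Qed.

Lemma cvg_ReIm {T : Type} (F : set_system T) {FF : Filter F} (u : T -> C) l :
  (fun t => complex.Re (u t)) @ F --> complex.Re l ->
  (fun t => complex.Im (u t)) @ F --> complex.Im l -> u @ F --> l.
Proof.
move=> /cvgrPdist_lt ur /cvgrPdist_lt ui; apply/cvgC => e e0.
have e2 : 0 < e / 2 by rewrite divr_gt0.
near=> t; apply: le_lt_trans (cmod_le_ReIm _) _; rewrite !raddfB/= [ltRHS]splitr.
by apply: ltrD; near: t; [exact: ur|exact: ui].
Unshelve. all: end_near. Qed.

Lemma open_cball y e : open [set x | cmod (x - y) < e].
Proof.
rewrite openE => x /= xe; apply/nbhs_normP.
have d0 : 0 < e - cmod (x - y) by rewrite subr_gt0.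
exists ((e - cmod (x - y))%:C)%C => /=; first by rewrite ltcR.
move=> w /=; rewrite lt_cmod => xw.
by have := cmodD (w - x) (x - y); rewrite subrKA (cmodBC w x) /=; lra.
Qed.

Lemma open_cballP (O : set C) x : open O -> O x ->
  exists2 e, 0 < e & forall w, cmod (x - w) < e -> O w.
Proof.
rewrite openE => /(_ x) + Ox => /(_ Ox)/nbhs_normP[_ /gt0_complex[e e0 ->] eO].
by exists e => // w xw; apply: eO; rewrite /= lt_cmod.
Qed.

Lemma compact_net (D : set C) e : compact D -> 0 < e ->
  exists s : seq C, forall x, D x -> has (fun y => cmod (x - y) < e) s.
Proof.
rewrite compact_cover => Dc e0.
have [|x Dx|s _ sD] := Dc C setT (fun y => [set x | cmod (x - y) < e]).
- by move=> y _; exact: open_cball.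
- by exists x => //=; rewrite subrr /cmod normr0.
exists (enum_fset s) => x /sD[y /= ys xy]; apply/hasP; exists y; [exact: ys|exact: xy].
Qed.

Lemma compact_bounded_dist (D : set C) y : compact D ->
  exists M, forall x, D x -> cmod (x - y) <= M.
Proof.
move=> /(@compact_net _ 1)/(_ ltr01)[s sD].
exists (1 + \sum_(w <- s) cmod (w - y)) => x /sD/hasP[w ws xw].
have := cmodD (x - w) (w - y); rewrite subrKA => /le_trans; apply.
apply: lerD; first exact: ltW.
by rewrite (big_rem w)//= lerDl sumr_ge0// => v _; exact: cmod_ge0.
Qed.

Section Rows.
Variables (D : set C) (j : nat).
Hypothesis D_compact : compact D.

Lemma cvg_row {T : Type} (F : set_system T) {FF : Filter F}
    (v : T -> 'rV[C]_j) (l : 'rV[C]_j) :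
  (forall k, (fun t => v t ord0 k) @ F --> l ord0 k) -> v @ F --> l.
Proof.
move=> vl A [Q lQ QA].
have := @filter_forall T 'I_j (fun k => [set t | Q ord0 k (v t ord0 k)]) F FF
  (fun k => vl k _ (lQ ord0 k)).
by apply: filterS => t tQ; apply: QA => i k; rewrite (ord1 i); exact: tQ.
Qed.

Lemma within_cvg {T : Type} (F : set_system T) {FF : Filter F}
    (p : 'rV[C]_j -> C) (v : T -> 'rV[C]_j) l :
  {within set_power D j, continuous p} -> set_power D j l ->
  (forall t, set_power D j (v t)) -> v @ F --> l -> (p \o v) @ F --> p l.
Proof.
move=> /subspace_continuousP/(_ l) pl Dl Dv vl A /(pl Dl) /= pA.
apply: (@filterS _ F FF _ _ _ (vl _ pA)) => t /= tA.
exact: tA (Dv t).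
Qed.

Lemma set_power_compact : compact (set_power D j).
Proof. exact: (@rV_compact C j (fun=> D)). Qed.

Lemma bounded_on_power (p : 'rV[C]_j -> C) :
  {within set_power D j, continuous p} ->
  exists M, forall v, set_power D j v -> cmod (p v) <= M.
Proof.
move=> pc; apply: contrapT => /forallNP nM.
have [v vP] : {v : nat -> 'rV[C]_j & forall n, set_power D j (v n) /\
    n%:R < cmod (p (v n))}.
  apply: (@choice _ _ (fun n v => set_power D j v /\ n%:R < cmod (p v))) => n.
  have /existsNP[v /not_implyP[Dv /negP]] := nM n%:R.
  by rewrite -ltNge => nv; exists v.
have [U [UU U_oo]] := ultraFilterLemma eventually_filter.
have [l Dl vl] := ultra_compact_cvg UU set_power_compact (fun n => (vP n).1).
have pvl : (p \o v) @ U --> p l.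
  exact: (within_cvg pc Dl (fun n => (vP n).1) vl).
have /cvgC/(_ _ ltr01) pl := pvl.
pose m := Num.bound (cmod (p l) + 1).
have [n [/= ln mn]] := ultra_meet UU pl (U_oo _ (nbhs_infty_ge m)).
have := (vP n).2; apply/negP; rewrite -leNgt.
apply: (@le_trans _ _ m%:R); last by rewrite ler_nat.
apply: (@le_trans _ _ (cmod (p l) + 1)).
  have := cmodD (p (v n) - p l) (p l); rewrite subrK cmodBC.
  by move: ln => /=; lra.
by apply/ltW/archi_boundP; rewrite addr_ge0// cmod_ge0.
Qed.

(** Pairs that violate the claim at distances [1 / n.+1] have a common limit along an ultrafilter,
    which lies in the compact power; continuity there gives a contradiction. *)
Lemma unif_continuous_on_power (p : 'rV[C]_j -> C) e :
  {within set_power D j, continuous p} -> 0 < e ->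
  exists2 d, 0 < d & forall v w, set_power D j v -> set_power D j w ->
    (forall k, cmod (v ord0 k - w ord0 k) < d) -> cmod (p v - p w) < e.
Proof.
move=> pc e0; apply: contrapT => nd.
have [vw vwP] : {vw : nat -> 'rV[C]_j * 'rV[C]_j & forall n,
    [/\ set_power D j (vw n).1, set_power D j (vw n).2,
      forall k, cmod ((vw n).1 ord0 k - (vw n).2 ord0 k) < n.+1%:R^-1 &
      e <= cmod (p (vw n).1 - p (vw n).2)]}.
  apply: (@choice _ _ (fun n vw => [/\ set_power D j vw.1, set_power D j vw.2,
    forall k, cmod (vw.1 ord0 k - vw.2 ord0 k) < n.+1%:R^-1 &
    e <= cmod (p vw.1 - p vw.2)])) => n.
  apply: contrapT => /forallNP nP; apply: nd; exists n.+1%:R^-1.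
    by rewrite invr_gt0.
  move=> v w Dv Dw vw; rewrite ltNge; apply/negP => evw.
  by apply: (nP (v, w)); split.
have Dv n : set_power D j (vw n).1 by case: (vwP n).
have Dw n : set_power D j (vw n).2 by case: (vwP n).
have [U [UU U_oo]] := ultraFilterLemma eventually_filter.
have [l Dl vl] := ultra_compact_cvg UU set_power_compact Dv.
have wl : (fun n => (vw n).2) @ U --> l.
  apply: cvg_row => k; apply/cvgC => d d0.
  have d2 : 0 < d / 2 by rewrite divr_gt0.
  have vlk : (fun n => (vw n).1 ord0 k) @ U --> l ord0 k.
    exact: (cvg_comp _ _ vl (coord_continuous (i := ord0) (j := k) (x := l))).
  have /cvgC/(_ _ d2) vd := vlk.
  have := U_oo _ (near_infty_natSinv_lt (PosNum d2)).
  move=> Ud; apply: filterS (filterI vd Ud) => n [/= lv nd2].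
  have [_ _ /(_ k) vwk _] := vwP n.
  have := cmodD (l ord0 k - (vw n).1 ord0 k) ((vw n).1 ord0 k - (vw n).2 ord0 k).
  by rewrite subrKA; move: vwk lv nd2 => /=; move: (n.+1%:R^-1) => c; lra.
have e2 : 0 < e / 2 by rewrite divr_gt0.
have pvl : (fun n => p (vw n).1) @ U --> p l by exact: within_cvg pc Dl Dv vl.
have pwl : (fun n => p (vw n).2) @ U --> p l by exact: within_cvg pc Dl Dw wl.
have /cvgC/(_ _ e2) pv := pvl; have /cvgC/(_ _ e2) pw := pwl.
have [n [/= nv nw]] := ultra_meet UU pv pw.
have [_ _ _] := vwP n.
have := cmodD (p (vw n).1 - p l) (p l - p (vw n).2); rewrite subrKA cmodBC.
by move: nv nw => /=; lra.
Qed.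

End Rows.
End ComplexModulus.

(** * From sequences to systems *)

Section FolnerAverages.
Variables (R : realType) (G : groupType) (F : nat -> {fset G}).
Implicit Types (u : G -> R[i]).

Lemma Re_natVM n (x : R[i]) :
  complex.Re ((n%:R : R[i])^-1 * x) = (n%:R)^-1 * complex.Re x.
Proof.
rewrite -(rmorph_nat (real_complex R)) -fmorphV/=.
by case: x => a b /=; rewrite mul0r subr0.
Qed.

Lemma Im_natVM n (x : R[i]) :
  complex.Im ((n%:R : R[i])^-1 * x) = (n%:R)^-1 * complex.Im x.
Proof.
rewrite -(rmorph_nat (real_complex R)) -fmorphV/=.
by case: x => a b /=; rewrite mul0r addr0.
Qed.

Lemma Re_folner_average u N : complex.Re (folner_average F u N) =
  average F (fun _ g => complex.Re (u g)) N.
Proof. by rewrite Re_natVM raddf_sum. Qed.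

Lemma Im_folner_average u N : complex.Im (folner_average F u N) =
  average F (fun _ g => complex.Im (u g)) N.
Proof. by rewrite Im_natVM raddf_sum. Qed.

End FolnerAverages.

Section Correspondence.
Variables (R : realType) (G : groupType) (F : nat -> {fset G}).
Hypothesis F_folner : left_folner R F.
Variable D : set R[i].
Hypothesis D_compact : compact D.

(** The distance from [f] to a fixed point is an ultralimit of bounded real functions, hence
    measurable by [loeb_mean]; this handles preimages of balls. *)
Lemma loeb_limit_measurable (U : set_system nat) (UU : UltraFilter U)
    (U_oo : \oo `<=` U) (z : G -> R[i]) (f : loeb_type G UU -> R[i]) :
  (forall g, D (z g)) -> (forall x, D (f x)) ->
  (forall x : loeb_type G UU, (fun N => z (x N)) @ U --> f x) ->
  borel_measurable f.
Proof.
move=> Dz Df zf.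
have [s sP] : {s : nat -> seq R[i] & forall n x, D x ->
    has (fun y => cmod (x - y) < n.+1%:R^-1) (s n)}.
  apply: (@choice _ _ (fun n s => forall x, D x ->
    has (fun y => cmod (x - y) < n.+1%:R^-1) s)) => n.
  by apply: compact_net => //; rewrite invr_gt0.
have mball y e : measurable [set x | cmod (f x - y) < e].
  have [M zM] : exists M, forall g, `|cmod (z g - y)| <= M.
    have [M DM] := compact_bounded_dist y D_compact.
    by exists M => g; rewrite ger0_norm ?cmod_ge0// DM.
  have [mu _ _] := loeb_mean F_folner.1 U_oo zM 
    (fun x : loeb_type G UU => cvg_cmod (y := y) (zf x)).
  rewrite (_ : [set x | _] =
    setT `&` (fun x => cmod (f x - y)) @^-1` `]-oo, e[%classic).
    exact: mu measurableT _ (measurable_itv _).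
  by rewrite setTI; apply/seteqP; split=> x /=; rewrite in_itv.
apply: (@measurability _ _ (loeb_type G UU) (g_sigma_algebraType (@open R[i]))
  setT f (@open R[i])) => //.
move=> _ [V oV <-]; rewrite setTI.
(* The values of [f] lie in [D], so countably many balls centred at net points and contained in [V]
   suffice. *)
have -> : f @^-1` V = \bigcup_n \bigcup_(k in
    [set k | [set x | cmod (x - nth 0 (s n) k) < n.+1%:R^-1] `<=` V])
    [set x | cmod (f x - nth 0 (s n) k) < n.+1%:R^-1].
  apply/seteqP; split=> [x /= Vx|x [n _ [k kV]]]; last exact: kV.
  have [e e0 eV] := open_cballP oV Vx.
  have e2 : 0 < e / 2 by rewrite divr_gt0.
  have [n _ /(_ n (leqnn n)) /= ne] := near_infty_natSinv_lt (PosNum e2).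
  have /hasP[y /(nthP 0)[k _ <-] xk] := sP n _ (Df x).
  exists n => //; exists k => //= w /= wk; apply: eV.
  move: ne xk wk; set c := n.+1%:R^-1; move: (nth _ _ _) c => v c ne xv wv.
  by have := cmodD (f x - v) (v - w); rewrite subrKA (cmodBC v w); lra.
by apply: bigcupT_measurable => n; apply: bigcup_measurable => k _; exact: mball.
Qed.

Theorem correspondence_principle (z : G -> R[i]) : (forall g, D (z g)) ->
  exists (d : measure_display) (X : measurableType d)
    (P : probability X R) (T : G -> X -> X) (f : X -> R[i]),
    [/\ measure_preserving_action P T,
        borel_measurable f,
        forall x, D (f x) &
        forall (j : nat) (h : 'I_j -> G) (p : 'rV[R[i]]_j -> R[i]),
          {within set_power D j, continuous p} ->
          cvg (folner_average F (fun g => p (\row_k z (h k * g)%g)) N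
                 @[N --> \oo]) ->
          folner_average F (fun g => p (\row_k z (h k * g)%g)) N
            @[N --> \oo]
            --> complex_integral P (fun x => p (\row_k f (T (h k) x)))].
Proof.
move=> Dz; have [U [UU U_oo]] := ultraFilterLemma eventually_filter.
have [f fP] : {f : loeb_type G UU -> R[i] & forall x, D (f x) /\
    (fun N => z (x N)) @ U --> f x}.
  apply: (@choice _ _ (fun (x : loeb_type G UU) l => D l /\ (fun N => z (x N)) @ U --> l)) => x.
  have [l Dl zl] := ultra_compact_cvg UU D_compact (fun N => Dz (x N)).
  by exists l.
have Df x := (fP x).1; have zf x := (fP x).2.
exists _, (loeb_type G UU), (@loeb_measure R G F F_folner.1 U UU U_oo),
  (@loeb_act G U UU), f; split.
- exact: loeb_act_mpa.
- exact: (loeb_limit_measurable U_oo Dz Df zf).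
- exact: Df.
move=> j h p pc /cvg_ex[l pl].
set u := fun g => p _ in pl *; set mu := loeb_measure _ _ _.
have Dzr g : set_power D j (\row_k z (h k * g)%g) by move=> k; rewrite mxE.
have ucvg (x : loeb_type G UU) :
    (fun N => u (x N)) @ U --> p (\row_k f (loeb_act (h k) x)).
  apply: (within_cvg (v := fun N => \row_k z (h k * x N)%g) pc) => [k|N|].
  - by rewrite mxE.
  - exact: Dzr.
  - apply: cvg_row => k; rewrite mxE.
    under eq_fun do rewrite mxE.
    exact: (zf (loeb_act (h k) x)).
have [M pM] := bounded_on_power D_compact pc.
(* Here the assumed convergence enters: as [U] refines the filter at infinity, the limit along [U]
   is the ordinary limit. *)
have plU : folner_average F u @ U --> l by exact: cvg_trans (cvg_app _ U_oo) pl.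
suff -> : complex_integral mu (fun x => p (\row_k f (loeb_act (h k) x))) = l by [].
have reE : \int[mu]_x complex.Re (p (\row_k f (loeb_act (h k) x))) = complex.Re l.
  have uM g : `|complex.Re (u g)| <= M.
    exact: le_trans (Re_le_cmod _) (pM _ (Dzr g)).
  have [_ _ ->] := loeb_mean F_folner.1 U_oo uM 
    (fun x : loeb_type G UU => cvg_Re (ucvg x)).
  apply: (ultra_limE UU); rewrite (_ : average _ _ = fun N =>
    complex.Re (folner_average F u N)); first exact: cvg_Re plU.
  by apply/funext => N; rewrite Re_folner_average.
have imE : \int[mu]_x complex.Im (p (\row_k f (loeb_act (h k) x))) = complex.Im l.
  have uM g : `|complex.Im (u g)| <= M.
    exact: le_trans (Im_le_cmod _) (pM _ (Dzr g)).
  have [_ _ ->] := loeb_mean F_folner.1 U_oo uM 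
    (fun x : loeb_type G UU => cvg_Im (ucvg x)).
  apply: (ultra_limE UU); rewrite (_ : average _ _ = fun N =>
    complex.Im (folner_average F u N)); first exact: cvg_Im plU.
  by apply/funext => N; rewrite Im_folner_average.
by rewrite /complex_integral reE imE; case: (l).
Qed.

End Correspondence.

(** * From systems to sequences *)

Section GenericOrbit.
Context {d : measure_display} (R : realType) (G : groupType).
Variables (F : nat -> {fset G}) (D : set R[i]).
Hypothesis F_folner : left_folner R F.
Variables (X : measurableType d) (P : probability X R) (T : G -> X -> X).
Variable f : X -> R[i].
Hypothesis T_mpa : measure_preserving_action P T.
Hypothesis f_borel : borel_measurable f.
Hypothesis Df : forall x, D (f x).
Variable net : nat -> seq R[i].
Hypothesis netP : forall n x, D x ->
  has (fun y => cmod (x - y) < n.+1%:R^-1) (net n).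
Variable e : nat -> G.
Hypothesis e_surj : forall g, exists k, e k = g.

(** The index of the first net point near [x]: this cuts [D] into finitely many Borel pieces of
    diameter at most [2 / m.+1]. *)
Definition code m (x : R[i]) : nat :=
  find (fun y => cmod (x - y) < m.+1%:R^-1) (net m).

Lemma code_lt m x : D x -> (code m x < size (net m))%N.
Proof. by move=> /(netP m); rewrite has_find. Qed.

Lemma code_dist m x y : D x -> D y -> code m x = code m y ->
  cmod (x - y) < 2 * m.+1%:R^-1.
Proof.
move=> Dx Dy xy; have := nth_find 0 (netP m Dx); have := nth_find 0 (netP m Dy).
rewrite -/(code m x) -/(code m y) xy; move: (nth _ _ _) (m.+1%:R^-1) => v c yv xv.
by have := cmodD (x - v) (v - y); rewrite subrKA (cmodBC v y); lra.
Qed.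

Lemma measurable_code m g c : measurable [set x | code m (f (T g x)) == c].
Proof.
have mball y r : measurable [set x | cmod (f x - y) < r].
  have /(f_borel measurableT) :
      (@open R[i]).-sigma.-measurable [set w | cmod (w - y) < r].
    by apply: sub_sigma_algebra; exact: open_cball.
  by rewrite setTI.
have mT (A : set X) : measurable A -> measurable [set x | A (T g x)].
  by move=> /(mpa_measurable T_mpa g measurableT); rewrite setTI.
rewrite /code; elim: (net m) c => [|y s IH] [|c] /=.
- by rewrite (_ : [set _ | _] = setT)//; apply/seteqP; split.
- by rewrite (_ : [set _ | _] = set0)//; apply/seteqP; split.
- rewrite (_ : [set x | _] = [set x | cmod (f (T g x) - y) < m.+1%:R^-1]).
    exact: mT (mball y _).
  by apply/seteqP; split=> x /=; case: ifP.
- rewrite (_ : [set x | _] =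
    ~` [set x | cmod (f (T g x) - y) < m.+1%:R^-1] `&` [set x | find
      (fun y => cmod (f (T g x) - y) < m.+1%:R^-1) s == c]).
    by apply: measurableI; [exact: measurableC (mT _ (mball y _))|exact: IH].
  by apply/seteqP; split=> x /=; case: ifP => // _ []// /(_ isT).
Qed.

(** An integer encodes a resolution and a finite list of constraints, each an index into the
    enumeration [e] with a prescribed code. Undecodable integers give the empty constraint. *)
Definition event_code (i : nat) : nat * seq (nat * nat) :=
  odflt (0%N, [::]) (choice.unpickle i).

Definition event (i : nat) (u : G -> R[i]) : Prop :=
  all (fun q => code (event_code i).1 (u (e q.1)) == q.2) (event_code i).2.

Definition window (i : nat) : seq G := [seq e q.1 | q <- (event_code i).2].

Lemma event_local i u v : (forall g, g \in window i -> u g = v g) ->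
  event i u -> event i v.
Proof.
move=> uv /allP ui; apply/allP => q qi; rewrite -uv; first exact: ui.
by apply/mapP; exists q.
Qed.

Lemma measurable_event i : measurable [set x | event i (fun g => f (T g x))].
Proof.
rewrite /event; elim: (event_code i).2 => [|q s IH] /=.
  by rewrite (_ : [set _ | _] = setT)//; apply/seteqP; split.
rewrite (_ : [set x | _] =
  [set x | code (event_code i).1 (f (T (e q.1) x)) == q.2] `&`
  [set x | all (fun q => code (event_code i).1 (f (T (e q.1) x)) == q.2) s]).
  by apply: measurableI => //; exact: measurable_code.
by apply/seteqP; split=> x /=; [move=> /andP[]|move=> [-> ->]].
Qed.

Variable z : G -> R[i].
Hypothesis Dz : forall g, D (z g).
Hypothesis z_freq : forall i, average F (fun _ g =>
    (`[< event i (fun h => z (h * g)%g) >])%:R) @ \oo -->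
  fine (P [set x | event i (fun h => f (T h x))]).

Section Test.
Variables (j : nat) (h : 'I_j -> G) (q : 'rV[R[i]]_j -> R).
Hypothesis q_unif : forall eps, 0 < eps -> exists2 r, 0 < r &
  forall v w, set_power D j v -> set_power D j w ->
    (forall k, cmod (v ord0 k - w ord0 k) < r) -> `|q v - q w| <= eps.

(** At resolution [m] with [2 / m.+1 < r], exactly one pattern occurs for each [u], and [q] varies
    by at most [eps] among points of the power sharing it. *)
Lemma finite_pattern eps : 0 < eps ->
  exists (I : finType) (i : I -> nat) (c : I -> R), forall u : G -> R[i],
    (forall g, D (u g)) ->
    `|q (\row_k u (h k)) - \sum_a c a * (`[< event (i a) u >])%:R| <= eps.
Proof.
move=> /q_unif[r r0 qr]; have r2 : 0 < r / 2 by rewrite divr_gt0.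
have [m _ /(_ m (leqnn m)) /= mr] := near_infty_natSinv_lt (PosNum r2).
have [idx idxP] := choice (fun k => e_surj (h k)).
pose K := size (net m); pose I := {ffun 'I_j -> 'I_K}.
pose i (a : I) := choice.pickle (m, [seq (idx k, val (a k)) | k <- enum 'I_j]).
pose pat (v : 'rV[R[i]]_j) (a : I) := [forall k, code m (v ord0 k) == a k].
have evE u a : event (i a) u = pat (\row_k u (h k)) a.
  rewrite /event /event_code /i choice.pickleK /= all_map /pat.
  congr is_true; apply/allP/forallP => H k; last first.
    by move=> _ /=; have := H k; rewrite mxE idxP.
  by have := H k (mem_enum _ k); rewrite /= mxE idxP.
(* The default [0] is used only for patterns realized by no point of the power; their events never
   hold for [u] in [D]. *)
exists I, i, (fun a => q (xget 0 [set v | set_power D j v /\ pat v a])) => u Du.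
have Dv : set_power D j (\row_k u (h k)) by move=> k; rewrite mxE.
set v := \row_k u (h k) in Dv *.
pose a0 : I := [ffun k => Ordinal (code_lt m (Dv k))].
have va0 : pat v a0 by apply/forallP => k; rewrite ffunE.
have patE a : pat v a -> a = a0.
  move=> /forallP va; apply/ffunP => k; apply/val_inj; rewrite ffunE /=.
  by rewrite (eqP (va k)).
rewrite (bigD1 a0)//= big1 => [|a aa0]; last first.
  rewrite asboolF ?mulr0// evE => /patE aE.
  by rewrite aE eqxx in aa0.
rewrite addr0 asboolT ?mulr1 ?evE//; case: xgetP => [w _ [Dw wa0]|/(_ v)]; last first.
  by move=> nv; exfalso; apply: nv.
apply: qr => // k; apply: lt_trans (_ : 2 * m.+1%:R^-1 < _).
  apply: code_dist; [exact: Dv|exact: Dw|].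
  by rewrite (eqP (forallP va0 k)) (eqP (forallP wa0 k)).
by move: mr; move: (m.+1%:R^-1) => c; lra.
Qed.

Lemma average_test : average F (fun _ g => q (\row_k z (h k * g)%g)) @ \oo -->
  \int[P]_x q (\row_k f (T (h k) x)).
Proof.
have simple (I : finType) (i : I -> nat) (c : I -> R) : has_mean P
    (fun x => \sum_a c a * (`[< event (i a) (fun g => f (T g x)) >])%:R)
    (\sum_a c a * fine (P [set x | event (i a) (fun g => f (T g x))])).
  apply: has_mean_sum => a; apply: has_meanZ.
  exact: has_mean_indic (measurable_event (i a)).
have um : has_mean P (fun x => q (\row_k f (T (h k) x)))
    (\int[P]_x q (\row_k f (T (h k) x))).
  apply: has_mean_approx => eps /finite_pattern[I [i [c ic]]].
  by do 2!eexists; split; [exact: simple i c|move=> x; exact: ic].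
apply/cvgrPdist_le => eps eps0; have eps3 : 0 < eps / 3 by rewrite divr_gt0.
have [I [i [c ic]]] := finite_pattern eps3.
have := has_mean_dist um (simple I i c) (fun x => ic _ (fun g => Df (T g x))).
set m := \int[P]_x _; set m' := \sum_a _ => mm'.
have cz : (fun N => \sum_a c a * average F (fun _ g =>
    (`[< event (i a) (fun h => z (h * g)%g) >])%:R) N) @ \oo --> m'.
  apply: cvg_big => [|a _]; first exact: add_continuous.
  by apply: cvgM; [exact: cvg_cst|exact: z_freq].
have /cvgrPdist_le/(_ _ eps3) near_m' := cz.
near=> N.
have m'N : `|m' - \sum_a c a * average F (fun _ g =>
    (`[< event (i a) (fun h => z (h * g)%g) >])%:R) N| <= eps / 3.
  by near: N; exact: near_m'.
have := @average_dist R G F F_folner.1 (fun _ g => q (\row_k z (h k * g)%g))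
  (fun _ g => \sum_a c a * (`[< event (i a) (fun h => z (h * g)%g) >])%:R) N
  _ (fun g => ic _ (fun h => Dz (h * g)%g)).
have -> : average F (fun _ g =>
    \sum_a c a * (`[< event (i a) (fun h => z (h * g)%g) >])%:R) N =
  \sum_a c a * average F (fun _ g =>
    (`[< event (i a) (fun h => z (h * g)%g) >])%:R) N :> R.
  rewrite /average exchange_big mulr_sumr; apply: eq_bigr => a _.
  by rewrite -mulr_sumr mulrCA.
move: m'N; set s := \sum_a _; set A := average _ _ _ => m's sA.
have -> : m - A = (m - m') + (m' - s) - (A - s) by ring.
apply: le_trans (ler_normB _ _) _; apply: le_trans (lerD (ler_normD _ _) sA) _.
by move: mm' m's; lra.
Unshelve. all: end_near. Qed.

End Test.

End GenericOrbit.

Section InverseCorrespondence.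
Context {d : measure_display} (R : realType) (G : groupType).
Variables (F : nat -> {fset G}) (D : set R[i]).
Hypothesis F_folner : left_folner R F.
Hypothesis G_countable : countable [set: G].
Hypothesis G_infinite : infinite_set [set: G].
Hypothesis D_compact : compact D.

Theorem inverse_correspondence (X : measurableType d) (P : probability X R)
    (T : G -> X -> X) (f : X -> R[i]) :
  measure_preserving_action P T -> borel_measurable f -> (forall x, D (f x)) ->
  exists z : G -> R[i], (forall g, D (z g)) /\
    forall (j : nat) (h : 'I_j -> G) (p : 'rV[R[i]]_j -> R[i]),
      {within set_power D j, continuous p} ->
      folner_average F (fun g => p (\row_k z (h k * g)%g)) N @[N --> \oo]
        --> complex_integral P (fun x => p (\row_k f (T (h k) x))).
Proof.
move=> T_mpa f_borel Df.
have [net netP] : {s : nat -> seq R[i] & forall n x, D x ->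
    has (fun y => cmod (x - y) < n.+1%:R^-1) (s n)}.
  apply: (@choice _ _ (fun n s => forall x, D x ->
    has (fun y => cmod (x - y) < n.+1%:R^-1) s)) => n.
  by apply: compact_net => //; rewrite invr_gt0.
have [e e_surj] := exists_enum G_countable.
have [z [zf z_freq]] := generic_sequence F_folner G_countable G_infinite T_mpa
  (@event_local R G net e) (measurable_event T_mpa f_borel net e).
(* Every value of [z] is a value of [f]. *)
have Dz g : D (z g) by have [x ->] := zf g.
exists z; split=> // j h p pc.
have reunif eps : 0 < eps -> exists2 r, 0 < r &
    forall v w, set_power D j v -> set_power D j w ->
    (forall k, cmod (v ord0 k - w ord0 k) < r) ->
    `|complex.Re (p v) - complex.Re (p w)| <= eps.
  move=> /(unif_continuous_on_power D_compact pc)[r r0 rp]; exists r => // v w Dv Dw vw.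
  by rewrite -raddfB (le_trans (Re_le_cmod _))// ltW// rp.
have imunif eps : 0 < eps -> exists2 r, 0 < r &
    forall v w, set_power D j v -> set_power D j w ->
    (forall k, cmod (v ord0 k - w ord0 k) < r) ->
    `|complex.Im (p v) - complex.Im (p w)| <= eps.
  move=> /(unif_continuous_on_power D_compact pc)[r r0 rp]; exists r => // v w Dv Dw vw.
  by rewrite -raddfB (le_trans (Im_le_cmod _))// ltW// rp.
apply: cvg_ReIm.
- under eq_fun do rewrite Re_folner_average.
  exact: (average_test F_folner T_mpa f_borel Df netP e_surj Dz z_freq (h := h)
    (q := fun v => complex.Re (p v)) reunif).
- under eq_fun do rewrite Im_folner_average.
  exact: (average_test F_folner T_mpa f_borel Df netP e_surj Dz z_freq (h := h)
    (q := fun v => complex.Im (p v)) imunif).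
Qed.

End InverseCorrespondence.

Theorem theorem2p7 (R : realType) (G : groupType)
    (G_countable : countable [set: G]) (G_infinite : infinite_set [set: G])
    (G_amenable : left_amenable R G)
    (F : nat -> {fset G}) (F_folner : left_folner R F)
    (D : set R[i]) (D_compact : compact D) :
  (forall (d : measure_display) (X : measurableType d) (P : probability X R)
      (T : G -> X -> X) (f : X -> R[i]),
      measure_preserving_action P T ->
      borel_measurable f -> (forall x, D (f x)) ->
      exists z : G -> R[i], (forall g, D (z g)) /\
        forall (j : nat) (h : 'I_j -> G) (p : 'rV[R[i]]_j -> R[i]),
          (0 < j)%N -> {within set_power D j, continuous p} ->
          folner_average F (fun g => p (\row_k z (h k * g)%g)) N
            @[N --> \oo]
            --> complex_integral P (fun x => p (\row_k f (T (h k) x))))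
  /\
  (forall z : G -> R[i], (forall g, D (z g)) ->
      exists (d : measure_display) (X : measurableType d)
        (P : probability X R) (T : G -> X -> X) (f : X -> R[i]),
        [/\ measure_preserving_action P T,
            borel_measurable f,
            forall x, D (f x) &
            forall (j : nat) (h : 'I_j -> G) (p : 'rV[R[i]]_j -> R[i]),
              (0 < j)%N -> {within set_power D j, continuous p} ->
              cvg (folner_average F (fun g => p (\row_k z (h k * g)%g)) N
                     @[N --> \oo]) ->
              folner_average F (fun g => p (\row_k z (h k * g)%g)) N
                @[N --> \oo]
                --> complex_integral P (fun x => p (\row_k f (T (h k) x)))]).
Proof.
split=> [d X P T f T_mpa f_borel Df|z Dz].
  have [z [Dz zP]] := inverse_correspondence F_folner G_countable G_infinite
    D_compact T_mpa f_borel Df.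
  by exists z; split; [exact: Dz|move=> j h p _; exact: zP].
have [d [X [P [T [f [T_mpa f_borel Df fP]]]]]] :=
  correspondence_principle F_folner D_compact Dz.
exists d, X, P, T, f; split; [exact: T_mpa|exact: f_borel|exact: Df|].
by move=> j h p _; exact: fP.
Qed.
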